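(* Let $a\ge 2$ and $b\ge 1$ be integers, and let $H=K_a+E_b$ be the disjoint union of an $a$-clique and a $b$-coclique. Then $$d^*\left(\mathrm{Forb}(K_a+E_b)\right)=\frac{1}{a+b-1}\qquad\text{and}\qquad p^*\left(\mathrm{Forb}(K_a+E_b)\right)=\frac{a-1}{a+b-1},$$ i.e. (for the first equality) $\mathrm{Dist}(n,\mathrm{Forb}(K_a+E_b))=\frac{1}{a+b-1}\binom{n}{2}-o(n^2)$.
   Context: All graphs are finite and simple. A coclique is a graph with no edges; $K_a$ is the complete graph on $a$ vertices, $E_b$ the empty graph on $b$ vertices, and $+$ denotes disjoint union of graphs. $\mathrm{Forb}(H)$ is the class of graphs with no induced copy of $H$. For a class of graphs $\mathcal{P}$ and a graph $G$, $\mathrm{Dist}(G,\mathcal{P})=\min\{|E(F)\triangle E(G)| : F\in\mathcal{P},\,V(F)=V(G)\}$ and $\mathrm{Dist}(n,\mathcal{P})=\max\{\mathrm{Dist}(G,\mathcal{P}):|V(G)|=n\}$. For a hereditary property $\mathcal{H}$ (a class of graphs closed under deletion of vertices), $d^*(\mathcal{H})=\lim_{n\to\infty}\mathrm{Dist}(n,\mathcal{H})/\binom{n}{2}$ (this limit exists), and $p^*(\mathcal{H})\in[0,1]$ is a value such that, with high probability, $\mathrm{Dist}(n,\mathcal{H})=\mathrm{Dist}(G(n,p^*(\mathcal{H})),\mathcal{H})+o(n^2)$, where $G(n,p)$ is the Erdős–Rényi random graph. *)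

(* Defs.v *)
From HB Require Import structures.
From mathcomp Require Import all_boot all_order all_algebra.

Set Implicit Arguments.
Unset Strict Implicit.
Unset Printing Implicit Defensive.

(* A finite simple graph on the vertex type V is given by its edge set, a set
   of two-element subsets of V. *)
Record sgraph (V : finType) := SGraph {
  edges :> {set {set V}};
  edges_card2 : edges \subset [set e : {set V} | #|e| == 2] }.

HB.instance Definition _ (V : finType) := [isSub for @edges V].
HB.instance Definition _ (V : finType) := [Finite of sgraph V by <:].

Definition adj (V : finType) (G : sgraph V) (x y : V) : bool :=
  [set x; y] \in edges G.

Definition complete_graph (V : finType) : sgraph V :=
  SGraph (subxx [set e : {set V} | #|e| == 2]).

Definition empty_graph (V : finType) : sgraph V :=
  SGraph (sub0set [set e : {set V} | #|e| == 2]).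

Section DisjointUnion.
Variables (V W : finType) (G : sgraph V) (H : sgraph W).

Definition djunion_edges : {set {set V + W}} :=
  [set [set inl x | x in e] | e : {set V} in edges G] :|:
  [set [set inr y | y in e] | e : {set W} in edges H].

Lemma djunion_card2 :
  djunion_edges \subset [set e : {set V + W} | #|e| == 2].
Proof.
apply/subsetP => e /setUP[] /imsetP[f fE ->]; rewrite inE.
  rewrite card_imset; last by move=> ? ? [].
  by have /subsetP/(_ _ fE) := edges_card2 G; rewrite inE.
rewrite card_imset; last by move=> ? ? [].
by have /subsetP/(_ _ fE) := edges_card2 H; rewrite inE.
Qed.

Definition djunion : sgraph (V + W)%type := SGraph djunion_card2.

End DisjointUnion.

Definition clique_plus_coclique (a b : nat) : sgraph ('I_a + 'I_b)%type :=
  djunion (complete_graph 'I_a) (empty_graph 'I_b).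

Definition induced_copy (W V : finType) (H : sgraph W) (G : sgraph V) : bool :=
  [exists f : {ffun W -> V},
    injectiveb f && [forall x, forall y, adj G (f x) (f y) == adj H x y]].

Definition graph_class := forall V : finType, pred (sgraph V).

Definition Forb (W : finType) (H : sgraph W) : graph_class :=
  fun V G => ~~ induced_copy H G.

Definition edit_dist (V : finType) (F G : sgraph V) : nat :=
  #|(edges F :\: edges G) :|: (edges G :\: edges F)|.

(* The default value 'C(#|V|, 2) bounds every edit distance on V, so it only
   matters when P contains no graph on V. *)
Definition Dist (P : graph_class) (V : finType) (G : sgraph V) : nat :=
  \big[Order.min/'C(#|V|, 2)]_(F : sgraph V | P V F) edit_dist F G.

Definition DistMax (P : graph_class) (n : nat) : nat :=
  \max_(G : sgraph 'I_n) Dist P G.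

(* Imported only here: the set notations of mathcomp-classical overlap with
   those of finset. *)
From mathcomp Require Import all_classical all_reals all_analysis.

Import Order.TTheory GRing.Theory Num.Theory.
Import numFieldNormedType.Exports.

Local Open Scope ring_scope.
Local Open Scope classical_set_scope.

Definition is_dstar (R : realType) (P : graph_class) (d : R) : Prop :=
  ((DistMax P n)%:R / 'C(n, 2)%:R : R) @[n --> \oo] --> d.

(* The probability that the Erdos-Renyi random graph G(n, p) satisfies A. *)
Definition Gnp_prob (R : realType) (n : nat) (p : R) (A : pred (sgraph 'I_n))
  : R :=
  \sum_(G : sgraph 'I_n | A G)
     p ^+ #|edges G| * (1 - p) ^+ ('C(n, 2) - #|edges G|).

(* "With high probability X = Y + o(n^2)" means that for each eps > 0 the
   event |X - Y| <= eps n^2 has probability tending to 1. *)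
Definition is_pstar (R : realType) (P : graph_class) (p : R) : Prop :=
  0 <= p <= 1 /\
  forall eps : R, 0 < eps ->
    Gnp_prob p (fun G : sgraph 'I_n =>
        `|(DistMax P n)%:R - (Dist P G)%:R| <= eps * n%:R ^+ 2)
      @[n --> \oo] --> (1 : R).

(* Main.v *)
Require Import Defs.
From mathcomp Require Import all_boot all_order all_algebra.
From mathcomp Require Import all_classical all_reals all_analysis.
From mathcomp Require Import fintype finset ring lra.

Set Implicit Arguments.
Unset Strict Implicit.
Unset Printing Implicit Defensive.

Import Order.TTheory GRing.Theory Num.Theory.
Import numFieldNormedType.Exports.

Local Open Scope ring_scope.

(** Put t = 1/(a+b-1), p = (a-1)t and q = bt, so that p + q = 1.

    Upper bound.  A graph whose vertices split into a-1 cocliques contains no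
    K_a, and one whose vertices split into b cliques contains no coclique on
    b+1 vertices; neither contains K_a + E_b.  A colouring with r colours that
    no recolouring of a single vertex improves makes at most a 1/r share of
    the pairs of any prescribed kind monochromatic ([good_coloring]).  Hence
    (a-1) Dist(G) <= e(G) and b Dist(G) <= C(n,2) - e(G) ([Dist_remove],
    [Dist_add]).  Adding up gives Dist(G) <= t C(n,2); and when the density of
    G stays away from p, one of the two bounds beats t C(n,2), which makes p*
    unique.

    Lower bound.  Let every pair of vertex sets X, Y of G span p|X||Y| edges
    up to eps n^2, and let F be free of K_a + E_b.  For a vertex v let d+(v)
    and d-(v) count the pairs at v added to and deleted from G in passing to F.
    Suppose d+(v) + d-(v) <= (1-gamma) t n for all v ([low_degree_edit]).
    Take a coclique B of F on b vertices, let s be the sum of d+ over B, and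
    let N consist of the vertices joined to B neither in F nor in G.  If B is
    typical, then |N| is at least about q^b (n - s/q), the d- neighbourhood of
    almost every vertex meets N in at most about q^b d- vertices, and F has no
    K_a inside N.  If almost all u in N had d+(u) >= s/b - gamma t n/2, then
    d-(u) <= (1-gamma/2) t n - s/b for them.  Choosing vertices of N one at a
    time inside F and G, each choice keeps a share p of the candidates and
    loses its deleted neighbours; a-1 choices lose altogether less than the
    available p|N|, exactly because p = (a-1)t and t/q = 1/b, so F would
    contain a K_a inside N ([greedy_cliques]).  So a positive share of N has
    smaller d+.  These vertices carry no K_a of F, hence by a Ramsey argument
    a positive density of cocliques of size b ([indep_tuples_count]), whose
    d+ sum is below s by a fixed multiple of n ([light_indep_descends]).
    This can be iterated until the d+ sum is negative, a contradiction.

    Typicality is meant on average over b-tuples: intersecting any fixed set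
    with the common neighbourhood of a random k-tuple scales its size by
    rho^k up to an average error of order k eps n ([common_dev]).  A vertex
    set minimising the number of changed pairs minus (1-gamma/2) t times its
    size squared is large and has bounded changed degrees, which reduces the
    general case to the one above ([edit_lower]).  Finally an exponential
    moment bound and a union bound over the 4^n pairs of vertex sets show that
    G(n,p) is quasirandom with probability at least 1 - 2/(n+1)
    ([Gnp_not_quasirandom]). *)

(** * Sums over tuples of vertices *)

Section Tsum.
Context {R : realFieldType} {V : finType}.
Implicit Types (Phi Psi : seq V -> R).

(** The sum of Phi over V^k.  Tuples are sequences grown at the head, so that
    an induction on k sums over the extensions of a tuple first. *)
Fixpoint tsum k Phi : R :=
  if k is k'.+1 then tsum k' (fun s => \sum_v Phi (v :: s)) else Phi [::].

Lemma ler_tsum k Phi Psi :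
  (forall s, size s = k -> Phi s <= Psi s) -> tsum k Phi <= tsum k Psi.
Proof.
elim: k Phi Psi => [|k IH] Phi Psi le_PhiPsi /=; first exact: le_PhiPsi.
by apply: IH => s sz_s; apply: ler_sum => v _; apply: le_PhiPsi; rewrite /= sz_s.
Qed.

Lemma eq_tsum k Phi Psi : Phi =1 Psi -> tsum k Phi = tsum k Psi.
Proof. by move=> e; apply/le_anti/andP; split; apply: ler_tsum => s _; rewrite e. Qed.

Lemma tsumD k Phi Psi :
  tsum k (fun s => Phi s + Psi s) = tsum k Phi + tsum k Psi.
Proof.
elim: k Phi Psi => [|k IH] Phi Psi //=.
by rewrite -IH; apply: eq_tsum => s; rewrite big_split.
Qed.

Lemma tsumZ k c Phi : tsum k (fun s => c * Phi s) = c * tsum k Phi.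
Proof.
elim: k Phi => [|k IH] Phi //=.
by rewrite -IH; apply: eq_tsum => s; rewrite mulr_sumr.
Qed.

Lemma tsumN k Phi : tsum k (fun s => - Phi s) = - tsum k Phi.
Proof. by rewrite -mulN1r -tsumZ; apply: eq_tsum => s; rewrite mulN1r. Qed.

Lemma tsum_const k c : tsum k (fun=> c) = c * #|V|%:R ^+ k.
Proof.
elim: k c => [|k IH] c /=; first by rewrite mulr1.
rewrite (_ : \sum_v c = c * #|V|%:R) ?IH ?exprS ?mulrA //.
by rewrite sumr_const mulr_natr.
Qed.

Lemma tsum_sum k (Phi : V -> seq V -> R) :
  tsum k (fun s => \sum_v Phi v s) = \sum_v tsum k (Phi v).
Proof.
elim: k Phi => [|k IH] Phi //=.
by rewrite -IH; apply: eq_tsum => s; rewrite exchange_big.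
Qed.

End Tsum.

(** * Common neighbourhoods in quasirandom graphs *)

Section Quasirandom.
Context {R : realFieldType} {V : finType}.
Implicit Types (A D G : rel V) (X Y W : {set V}) (s : seq V) (rho eps : R).
Local Notation n := (#|V|%:R : R).

Definition nbhd A X v : {set V} := [set z in X | A v z].
Definition deg A X v : R := #|nbhd A X v|%:R.
Definition common A X s : {set V} := [set z in X | all (A^~ z) s].

(** Ordered pairs are counted: an edge inside both X and Y counts twice.  G may
    have loops, so that the complement relation is covered as well. *)
Definition quasirandom rho eps G := forall X Y,
  `|\sum_(x in X) deg G Y x - rho * #|X|%:R * #|Y|%:R| <= eps * n ^+ 2.

Lemma common_cons A X v s : common A X (v :: s) = nbhd A (common A X s) v.
Proof.
apply/setP => z; rewrite !inE /=.
by case: (z \in X); case: (A v z); rewrite ?andbT ?andbF.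
Qed.

(** Among the vertices of degree into Y above average, and among those below
    it, all deviations have the same sign, so each half of the sum is a single
    discrepancy. *)
Lemma deg_dev rho eps G Y : quasirandom rho eps G ->
  \sum_v `|deg G Y v - rho * #|Y|%:R| <= 2 * eps * n ^+ 2.
Proof.
move=> qr.
pose X := [set v | rho * #|Y|%:R <= deg G Y v].
have dX : forall Z : {set V}, \sum_(v in Z) (deg G Y v - rho * #|Y|%:R) =
    \sum_(v in Z) deg G Y v - rho * #|Z|%:R * #|Y|%:R.
  move=> Z; rewrite sumrB sumr_const; congr (_ - _).
  by rewrite -[LHS]mulr_natr mulrAC.
rewrite (bigID (mem X)) /=.
have -> : \sum_(v in X) `|deg G Y v - rho * #|Y|%:R| =
          \sum_(v in X) (deg G Y v - rho * #|Y|%:R).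
  by apply: eq_bigr => v; rewrite inE => h; rewrite ger0_norm // subr_ge0.
have -> : \sum_(v | v \notin X) `|deg G Y v - rho * #|Y|%:R| =
          - \sum_(v in ~: X) (deg G Y v - rho * #|Y|%:R).
  rewrite -sumrN; apply: eq_big => [v|v]; first by rewrite in_setC.
  by rewrite inE -ltNge => h; rewrite ltr0_norm // subr_lt0.
rewrite !dX.
have := qr X Y; have := qr (~: X) Y.
rewrite !ler_norml => /andP[h1 h2] /andP[h3 h4]; lra.
Qed.

Lemma quasirandom_eps_ge0 rho eps G : quasirandom rho eps G -> 0 <= eps * n ^+ 2.
Proof. by move=> /(_ set0 set0); apply: le_trans; rewrite normr_ge0. Qed.

(** The common neighbourhood of the first k vertices does not depend on the
    next one, so [deg_dev] applies to it: one more vertex scales the size by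
    rho at the price of 2 eps n^2. *)
Lemma common_dev rho eps G X k : 0 <= rho <= 1 -> quasirandom rho eps G ->
  tsum k (fun s => `|#|common G X s|%:R - rho ^+ k * #|X|%:R|)
    <= 2 * k%:R * eps * n ^+ k.+1.
Proof.
move=> /andP[rho0 rho1] qr; elim: k => [|k IH].
  rewrite /= (_ : common G X [::] = X); last by apply/setP => z; rewrite !inE andbT.
  by rewrite expr0 mul1r subrr normr0; lra.
rewrite /=.
apply: (@le_trans _ _ (tsum k (fun s => 2 * eps * n ^+ 2 +
   n * `|#|common G X s|%:R - rho ^+ k * #|X|%:R|))).
  apply: ler_tsum => s _.
  apply: le_trans (lerD (deg_dev (common G X s) qr) (lexx _)).
  rewrite (_ : n * _ = \sum_(v : V) `|#|common G X s|%:R - rho ^+ k * #|X|%:R|); last first.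
    by rewrite sumr_const mulr_natl.
  rewrite -big_split /=; apply: ler_sum => v _.
  rewrite common_cons -[#|nbhd _ _ _|%:R]/(deg G (common G X s) v) exprS.
  set c := #|common _ _ _|%:R; set x := #|X|%:R; set d := deg _ _ _.
  rewrite (_ : d - rho * rho ^+ k * x = (d - rho * c) + rho * (c - rho ^+ k * x)); last by ring.
  apply: le_trans (ler_normD _ _) _; rewrite lerD2l normrM ger0_norm //.
  by rewrite ler_piMl.
rewrite tsumD tsum_const tsumZ -natr1.
have n0 : 0 <= n by rewrite ler0n.
have := ler_wpM2l n0 IH.
rewrite [in X in _ -> _ <= X]exprS => h.
apply: le_trans (lerD (lexx _) h) _.
rewrite -[_ * _ ^+ 2 * _]mulrA -exprD exprS.
rewrite le_eqVlt; apply/orP; left; apply/eqP; rewrite addnC addn2 !exprS; ring.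
Qed.

Definition rel_diff G D : rel V := fun x y => G x y && ~~ D x y.

(** Error terms accumulated while a tuple grows, when the neighbourhood of
    each vertex v is its G-neighbourhood without the forbidden set D(v). *)
Fixpoint common_loss rho G D W s : R :=
  if s is v :: s' then
    `|deg G (common (rel_diff G D) W s') v
       - rho * #|common (rel_diff G D) W s'|%:R|
    + `|#|common G (nbhd D W v) s'|%:R - rho ^+ size s' * deg D W v|
    + common_loss rho G D W s'
  else 0.

Lemma common_loss_ge0 rho G D W s : 0 <= common_loss rho G D W s.
Proof. by elim: s => //= v s IH; rewrite !addr_ge0. Qed.

(** The forbidden set of one vertex is itself thinned by the other k-1
    vertices of the tuple, so it costs only rho^(k-1) |D(v)|. *)
Lemma common_loss_lower rho G D W s : 0 <= rho <= 1 ->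
  rho ^+ size s * #|W|%:R - rho ^+ (size s).-1 * (\sum_(v <- s) deg D W v)
    - common_loss rho G D W s
  <= #|common (rel_diff G D) W s|%:R.
Proof.
move=> /andP[rho0 rho1]; elim: s => [|v s IH].
  rewrite /= big_nil mulr0 !subr0 mul1r ler_nat; apply: subset_leq_card.
  by apply/subsetP => z zW; rewrite !inE zW.
rewrite big_cons /=.
set A := rel_diff G D in IH *.
have sub : (nbhd G (common A W s) v) \subset
    nbhd A (common A W s) v :|: common G (nbhd D W v) s.
  apply/subsetP => z; rewrite !inE => /andP[/andP[zW Az] Gz].
  rewrite zW Az /= /A /rel_diff Gz /=; case: (D v z) => //=.
  by apply/allP => x xs; have /allP/(_ x xs)/andP[] := Az.
have {sub} := subset_leq_card sub.
move/leq_trans => /(_ _ (leq_card_setU _ _)); rewrite -(ler_nat R) natrD -common_cons.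
rewrite -[#|nbhd G _ _|%:R]/(deg G (common A W s) v) => h1.
have h2 := ler_norm (rho * #|common A W s|%:R - deg G (common A W s) v).
rewrite distrC in h2.
have h3 := ler_norm (#|common G (nbhd D W v) s|%:R - rho ^+ size s * deg D W v).
have h4 := ler_wpM2l rho0 IH.
have h5 : rho * common_loss rho G D W s <= common_loss rho G D W s.
  by rewrite ler_piMl // common_loss_ge0.
have h6 : rho * (rho ^+ (size s).-1 * (\sum_(v <- s) deg D W v)) =
          rho ^+ size s * (\sum_(v <- s) deg D W v).
  by case: s {IH h1 h2 h3 h4 h5} => [|w s]; rewrite ?big_nil ?mulr0 //= exprS mulrA.
rewrite exprS; move: h4; rewrite !mulrBr mulrDr h6 mulrA => h4.
lra.
Qed.

Lemma tsum_common_loss rho eps G D W k : 0 <= rho <= 1 -> quasirandom rho eps G ->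
  tsum k (common_loss rho G D W) <= (k * k.+1)%:R * eps * n ^+ k.+1.
Proof.
move=> rho01 qr; elim: k => [|k IH]; first by rewrite /= !mul0r.
rewrite /=.
set A := rel_diff G D.
pose e1 s : R := \sum_v `|deg G (common A W s) v - rho * #|common A W s|%:R|.
pose e2 s : R := \sum_v `|#|common G (nbhd D W v) s|%:R - rho ^+ k * deg D W v|.
apply: (@le_trans _ _ (tsum k (fun s => (e1 s + e2 s) + n * common_loss rho G D W s))).
  apply: ler_tsum => s sz_s; rewrite sz_s !big_split /= lerD2l.
  by rewrite sumr_const mulr_natl.
rewrite !tsumD tsumZ.
have n0 : 0 <= n by rewrite ler0n.
have h1 : tsum k e1 <= 2 * eps * n ^+ 2 * n ^+ k.
  by rewrite -tsum_const; apply: ler_tsum => s _; apply: deg_dev.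
have h2 : tsum k e2 <= n * (2 * k%:R * eps * n ^+ k.+1).
  rewrite tsum_sum mulr_natl -sumr_const; apply: ler_sum => v _; exact: common_dev.
have h3 := ler_wpM2l n0 IH.
apply: le_trans (lerD (lerD h1 h2) h3) _.
rewrite le_eqVlt; apply/orP; left; apply/eqP.
by rewrite !natrM -!natr1 !exprS; ring.
Qed.

Definition clique A W s := all (mem W) s && pairwise A s.

Lemma sum_clique_cons A W s : symmetric A ->
  \sum_v (clique A W (v :: s))%:R = (clique A W s)%:R * #|common A W s|%:R :> R.
Proof.
move=> symA; rewrite -natr_sum -natrM; congr _%:R.
rewrite /clique /=.
have [Es|nEs] := boolP (all (mem W) s && pairwise A s); last first.
  rewrite mul0n big1 // => v _; apply/eqP; rewrite eqb0.
  by apply: contra nEs => /and3P[/andP[_ ->] _ ->].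
have /andP[-> ->] := Es.
rewrite mul1n -sum1_card [in RHS]big_mkcond /=; apply: eq_bigr => v _.
rewrite !inE !andbT (@eq_all _ (A v) (A^~ v)) => [|z]; last by rewrite symA.
by case: (_ && _).
Qed.

(** Greedy choice of a clique inside W.  A clique on j < k vertices typically
    has at least rho^(j-1) (rho |W| - j lambda) extensions, which the budget
    hypothesis keeps above rho^k eta n; half of this pays for the average
    error. *)
Lemma greedy_cliques rho eps eta lambda G D A W k :
  0 <= rho <= 1 -> quasirandom rho eps G ->
  (forall x y, A x y = G x y && ~~ D x y) -> symmetric A ->
  0 <= lambda -> (forall w, w \in W -> deg D W w <= lambda) ->
  0 <= eta <= 1 -> k.-1%:R * lambda + eta * n <= rho * #|W|%:R ->
  (k * k.+1)%:R * eps <= (rho ^+ k * eta / 2) ^+ k ->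
  (rho ^+ k * eta / 2 * n) ^+ k <= tsum k (fun s => (clique A W s)%:R).
Proof.
move=> rho01 qr AE symA lam0 degD /andP[eta0 eta1] Wbig eps_small.
have /andP[rho0 rho1] := rho01.
have n0 : 0 <= n by rewrite ler0n.
set zeta := rho ^+ k * eta / 2 in eps_small *.
have zeta01 : 0 <= zeta <= 1.
  have := exprn_ile1 k rho0 rho1; have := exprn_ge0 k rho0.
  rewrite /zeta; move: (rho ^+ k) => r r0 r1; apply/andP; split; nra.
have /andP[zeta0 zeta1] := zeta01.
have eqc s : common (rel_diff G D) W s = common A W s.
  by apply/setP => z; rewrite !inE; congr (_ && _); apply: eq_all => x; rewrite AE.
have ext s : (size s < k)%N -> all (mem W) s ->
    2 * zeta * n - common_loss rho G D W s <= #|common A W s|%:R.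
  move=> sz sW; have := @common_loss_lower rho G D W s rho01; rewrite eqc.
  apply: le_trans; rewrite lerB //.
  have sumd : \sum_(v <- s) deg D W v <= (size s)%:R * lambda.
    elim: s sW {sz} => [|v s IH] /=; first by rewrite big_nil mul0r.
    move=> /andP[vW sW]; rewrite big_cons -natr1 mulrDl mul1r addrC.
    by apply: lerD; [apply: IH | apply: degD].
  (* 2 zeta n is the guaranteed number of extensions; zeta n is what remains
     of it after the error terms. *)
  have le1 : 2 * zeta * n <= rho ^+ (size s).-1 * (eta * n).
    rewrite /zeta (_ : 2 * _ * n = rho ^+ k * (eta * n)); last by field.
    apply: ler_wpM2r; first by rewrite mulr_ge0.
    by apply: ler_wiXn2l => //; rewrite (leq_trans (leq_pred _)) // ltnW.
  apply: le_trans le1 _.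
  case: s sz sW sumd => [|v s] /= sz sW sumd.
    rewrite big_nil mulr0 subr0 !mul1r.
    have := ler0n R #|W|; have : 0 <= k.-1%:R * lambda by rewrite mulr_ge0.
    move: Wbig; set w := #|W|%:R; nra.
  rewrite exprSr -mulrA -mulrBr; apply: ler_wpM2l; first exact: exprn_ge0.
  rewrite lerBrDl; apply: le_trans Wbig; rewrite lerD2r.
  apply: le_trans sumd _; apply: ler_wpM2r => //.
  by rewrite ler_nat -ltnS (ltn_predK sz).
have main j : (j <= k)%N -> (zeta * n) ^+ j <= tsum j (fun s => (clique A W s)%:R).
  elim: j => [|j IH] jk; first by rewrite /= /clique /=.
  rewrite /=.
  apply: (@le_trans _ _ (tsum j (fun s => 2 * zeta * n * (clique A W s)%:R
                                         - common_loss rho G D W s))); last first.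
    apply: ler_tsum => s sz_s; rewrite sum_clique_cons //.
    case: (boolP (clique A W s)) => [/andP[sW _]|_].
      by rewrite mulr1 mul1r ext // sz_s.
    by rewrite mulr0 mul0r sub0r oppr_le0 common_loss_ge0.
  rewrite tsumD tsumN tsumZ.
  have h1 := ler_wpM2l (mulr_ge0 zeta0 n0) (IH (ltnW jk)).
  have h3 : (j * j.+1)%:R * eps * n ^+ j.+1 <= (zeta * n) ^+ j.+1.
    rewrite [leRHS]exprMn; case: (eqVneq n 0) => [->|nn0].
      by rewrite expr0n /= !mulr0.
    have np : 0 < n by rewrite lt_def nn0.
    rewrite ler_pM2r ?exprn_gt0 //.
    have eps0 : 0 <= eps.
      by have := quasirandom_eps_ge0 qr; rewrite pmulr_lge0 // exprn_gt0.
    apply: (@le_trans _ _ ((k * k.+1)%:R * eps)).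
      by apply: ler_wpM2r => //; rewrite ler_nat leq_mul // ltnW.
    apply: le_trans eps_small _; exact: ler_wiXn2l.
  have {h3} := le_trans (tsum_common_loss D W j rho01 qr) h3.
  rewrite -exprS in h1; rewrite -!mulrA in h1 *.
  move: h1; set x := _ ^+ _; set y := _ * tsum _ _; set z := tsum _ _; lra.
exact: main (leqnn k).
Qed.

End Quasirandom.

(** * Counting cocliques in clique-free sets *)

Section Ramsey.
Context {R : realFieldType} {V : finType}.
Implicit Types (A F G : rel V) (X Y W : {set V}) (s : seq V).
Local Notation n := (#|V|%:R : R).

Definition nonadj F : rel V := fun x y => (x != y) && ~~ F x y.

(** The copy is automatically injective: [nonadj] excludes equality, and F will
    be irreflexive. *)
Definition copy_free a b F := forall r s, size r = a -> size s = b ->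
  pairwise F r -> pairwise (nonadj F) s ->
  ~~ all (fun x => all (nonadj F x) s) r.

Lemma nonadj_sym F : symmetric F -> symmetric (nonadj F).
Proof. by move=> symF x y; rewrite /nonadj symF eq_sym. Qed.

Lemma clique_sub A X Y s : X \subset Y -> clique A X s -> clique A Y s.
Proof.
move=> /subsetP sXY /andP[sX As]; rewrite /clique As andbT.
by apply/allP => x /(allP sX) /sXY.
Qed.

Lemma ler_tsum_pred k (P Q : pred (seq V)) :
  (forall s, size s = k -> P s -> Q s) ->
  tsum k (fun s => (P s)%:R) <= tsum k (fun s => (Q s)%:R) :> R.
Proof.
move=> PQ; apply: ler_tsum => s sz_s; rewrite ler_nat.
by case Ps: (P s) => //; rewrite PQ.
Qed.

Lemma quasirandom_full : quasirandom (1 : R) 0 (fun _ _ : V => true).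
Proof.
move=> X Y; rewrite mul0r mul1r.
rewrite (eq_bigr (fun=> #|Y|%:R)).
  by rewrite sumr_const -[_ *+ _]mulr_natl subrr normr0.
by move=> x _; congr (#|pred_of_set _|%:R); apply/setP => z; rewrite !inE andbT.
Qed.

Lemma quasirandom_compl rho eps G : quasirandom rho eps G ->
  quasirandom (1 - rho : R) eps (fun x y => ~~ G x y).
Proof.
move=> qr X Y; have := qr X Y.
rewrite (_ : \sum_(x in X) deg (fun x y => ~~ G x y) Y x =
             #|X|%:R * #|Y|%:R - \sum_(x in X) deg G Y x :> R); last first.
  rewrite mulr_natl -sumr_const -sumrB; apply: eq_bigr => x _.
  apply/eqP; rewrite eq_sym subr_eq -natrD; apply/eqP; congr _%:R.
  rewrite addnC -cardsUI (_ : _ :&: _ = set0) ?cards0 ?addn0.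
    by apply: eq_card => z; rewrite !inE; case: (G x z); rewrite ?andbT ?andbF ?orbF.
  by apply/setP => z; rewrite !inE; case: (G x z); rewrite ?andbT ?andbF.
rewrite -normrN; congr (`|_| <= _); ring.
Qed.

(** Ramsey's theorem with a count.  If some vertex has a large neighbourhood
    inside W, that neighbourhood contains no clique on a-1 vertices and
    induction on a applies.  Otherwise all degrees are so small that b vertices
    can be chosen greedily; this is [greedy_cliques] in the full relation. *)
Lemma indep_tuples_count b a (x : R) F W : (0 < b)%N -> symmetric F -> irreflexive F ->
  4 * b%:R <= x -> x * (2 * b%:R) ^+ a <= #|W|%:R ->
  (forall s, size s = a -> ~~ clique F W s) ->
  (x / 4) ^+ b <= tsum b (fun s => (clique (nonadj F) W s)%:R).
Proof.
move=> b_gt0 symF irrF bx.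
have b1 : 1 <= b%:R :> R by rewrite ler1n.
elim: a W => [|a IH] W xW noK; first by have := noK [::] erefl.
have pow1 : 1 <= (2 * b%:R) ^+ a :> R by apply: exprn_ege1; lra.
have [/existsP[v /andP[vW dv]]|] := boolP [exists v, (v \in W) &&
    (x * (2 * b%:R) ^+ a <= deg F W v)].
  have sub : nbhd F W v \subset W by apply/subsetP => z; rewrite inE => /andP[].
  apply: le_trans (IH _ dv _) _; last first.
    by apply: ler_tsum_pred => s _; apply: clique_sub.
  move=> s sz_s; apply/negP => /andP[sN Fs].
  have := noK (v :: s); rewrite /= sz_s => /(_ erefl)/negP; apply.
  rewrite /clique /= vW Fs andbT /=; apply/andP; split; apply/allP => z /(allP sN);
    by rewrite /= inE => /andP[].
rewrite negb_exists => /forallP noV.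
pose w : R := #|W|%:R.
have wn : w <= n by rewrite ler_nat max_card.
rewrite exprSr mulrA in xW.
set X := x * _ in xW noV.
have xX : x <= X by rewrite ler_peMr //; lra.
have Xw : 2 * X <= w by apply: le_trans xW; nra.
have n_gt0 : 0 < n by lra.
rewrite -[#|W|%:R]/w in xW.
have -> : x / 4 = 1 ^+ b * (x / (2 * n)) / 2 * n.
  rewrite expr1n; field; lra.
apply: (@greedy_cliques R V 1 0 (x / (2 * n)) (X + 1) (fun _ _ => true)
    (fun y z => (y == z) || F y z)) => //.
- by rewrite ler01 lexx.
- exact: quasirandom_full.
- by move=> y z; rewrite /nonadj negb_or.
- exact: nonadj_sym.
- lra.
- move=> v vW; have := noV v; rewrite vW /= -ltNge => /ltW dv.
  apply: le_trans (_ : deg F W v + 1 <= _); last by lra.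
  rewrite /deg natr1 ler_nat; apply: leq_trans (_ : #|v |: nbhd F W v| <= _)%N.
    apply: subset_leq_card; apply/subsetP => z; rewrite !inE eq_sym.
    by case: (z == v) => //= ->.
  by rewrite cardsU1 addnC -addn1 leq_add2l leq_b1.
- rewrite divr_ge0 ?ler_pdivrMr /=; lra.
- rewrite mul1r -[#|W|%:R]/w (_ : x / (2 * n) * n = x / 2); last by field; lra.
  have -> : b.-1%:R = b%:R - 1 :> R by rewrite -subn1 natrB.
  move: xW; set B : R := b%:R in b1 bx *; nra.
- by rewrite mulr0 exprn_ge0 // expr1n mul1r !divr_ge0 //; lra.
Qed.

End Ramsey.

(** * No copy-free graph is close to a quasirandom graph at every vertex *)

Section Core.
Context {R : archiRealFieldType}.
Variables (a b : nat) (gam : R).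
Hypotheses (a_gt1 : (1 < a)%N) (b_gt0 : (0 < b)%N) (gam01 : 0 < gam <= 1).

(** The limit density d*; then p* = (a-1) rate and 1 - p* = b rate. *)
Definition rate : R := 1 / (a%:R + b%:R - 1).
Local Notation t := rate.
Local Notation p := (a.-1%:R * t).
Local Notation q := (b%:R * t).

Lemma rate_gt0 : 0 < t.
Proof.
rewrite /rate divr_gt0 // -addrA ltr_wpDr ?ltr0n ?subr_ge0 ?ler1n //.
exact: ltn_trans a_gt1.
Qed.

Lemma rate_split : p + q = 1.
Proof.
have := rate_gt0; rewrite /rate => t0; rewrite -mulrDl -subn1 natrB 1?ltnW //.
rewrite (_ : a%:R - 1 + b%:R = a%:R + b%:R - 1); last by ring.
rewrite mul1r divff //; apply: contraTneq t0 => ->; by rewrite invr0 mulr0 ltxx.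
Qed.

(* (a-1) mu n is the surplus in the greedy choice of K_a.  The tolerances dlt,
   theta and mu / 8 are small enough to consume at most half of it. *)
Let mu := q ^+ b * gam * t / 2.
Let dlt := mu / 8.
Let theta := mu ^+ 2 / 64.

(** The density of cocliques that [indep_tuples_count] provides in a
    K_a-free set of dlt n vertices. *)
Definition ramsey_density := (dlt / (4 * (2 * b%:R) ^+ a)) ^+ b.

Section Graph.
Variables (V : finType) (F G : rel V) (eps : R).
Local Notation n := (#|V|%:R : R).
Hypotheses (symF : symmetric F) (irrF : irreflexive F) (symG : symmetric G).
Hypotheses (qrG : quasirandom p eps G).
Hypothesis noH : copy_free a b F.

(** The diagonal is included so that avoiding both G and [added] means being
    distinct and non-adjacent in F. *)
Definition added : rel V := fun x y => ~~ G x y && (F x y || (x == y)).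
Definition deleted : rel V := fun x y => G x y && ~~ F x y.
Local Notation dp := (deg added setT : V -> R).
Local Notation dm := (deg deleted setT : V -> R).
Hypothesis degD : forall v, dp v + dm v <= (1 - gam) * t * n.

Definition light_indep sigma (s : seq V) :=
  clique (nonadj F) setT s && (\sum_(v <- s) dp v <= sigma).

Let Gc : rel V := fun x y => ~~ G x y.

(* The first term bounds from below the vertices joined to s neither in F nor
   in G; the second one controls the trace of the deleted neighbourhoods on
   the common non-neighbourhood of s in G. *)
Let atypicality s := n * common_loss q Gc added setT s +
  \sum_u `|#|common Gc (nbhd deleted setT u) s|%:R - q ^+ b * dm u|.

Let t0 := rate_gt0.
Let b1 : 1 <= b%:R :> R. Proof. by rewrite ler1n. Qed.
Let a1 : 1 <= a.-1%:R :> R. Proof. by rewrite ler1n -subn1 subn_gt0. Qed.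
Let p0 : 0 < p. Proof. by rewrite mulr_gt0 // (lt_le_trans ltr01 a1). Qed.
Let q0 : 0 < q. Proof. by rewrite mulr_gt0 // (lt_le_trans ltr01 b1). Qed.
Let p1 : p <= 1. Proof. by rewrite -[leRHS]rate_split lerDl ltW. Qed.
Let q1 : q <= 1. Proof. by rewrite -[leRHS]rate_split lerDr ltW. Qed.
Let t1 : t <= 1. Proof. by apply: le_trans p1; rewrite ler_peMl // ltW. Qed.
Let qrGc : quasirandom q eps Gc.
Proof.
rewrite (_ : q = 1 - p); last by rewrite -[X in X - _]rate_split addrC addKr.
exact: quasirandom_compl.
Qed.
Let qb0 : 0 < q ^+ b. Proof. exact: exprn_gt0. Qed.
Let qb1 : q ^+ b <= 1. Proof. by apply: exprn_ile1; rewrite // ltW. Qed.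
Let mu0 : 0 < mu.
Proof.
have /andP[g0 _] := gam01.
exact: divr_gt0 (mulr_gt0 (mulr_gt0 qb0 g0) t0) (ltr0Sn _ _).
Qed.
Let mu1 : mu <= 1 / 2.
Proof.
have /andP[g0 g1] := gam01; rewrite /mu ler_pM2r ?invr_gt0 ?ltr0n //.
have h : q ^+ b * gam <= 1 by apply: mulr_ile1 => //; exact: ltW.
by apply: mulr_ile1 => //; [exact: ltW (mulr_gt0 qb0 g0) | exact: ltW].
Qed.

Lemma rel_diff_deletedE x y : rel_diff G deleted x y = G x y && F x y.
Proof. by rewrite /rel_diff /deleted; case: (G x y); case: (F x y). Qed.

Lemma rel_diff_addedE x y : rel_diff Gc added x y = Gc x y && nonadj F x y.
Proof.
rewrite /rel_diff /added /Gc /nonadj negb_and negb_or !negbK.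
by case: (G x y); case: (F x y); case: eqVneq.
Qed.

Lemma tsum_atypicality : tsum b atypicality <= (b * b.+1 + 2 * b)%:R * eps * n ^+ b.+2.
Proof.
rewrite tsumD tsumZ tsum_sum.
have q01 : 0 <= q <= 1 by rewrite q1 ltW.
have n0 : 0 <= n by rewrite ler0n.
have h1 := ler_wpM2l n0 (tsum_common_loss added setT b q01 qrGc).
have h2 : \sum_v tsum b (fun s => `|#|common Gc (nbhd deleted setT v) s|%:R - q ^+ b * dm v|)
   <= n * (2 * b%:R * eps * n ^+ b.+1).
  by rewrite [leRHS]mulr_natl -sumr_const; apply: ler_sum => v _; exact: common_dev.
apply: le_trans (lerD h1 h2) _.
by rewrite le_eqVlt; apply/orP; left; apply/eqP; rewrite natrD !natrM !exprS; ring.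
Qed.

Hypothesis n_big : 4 * b%:R * (2 * b%:R) ^+ a <= dlt * n.
Hypothesis eps_small_a : (a * a.+1)%:R * eps <= (p ^+ a * (mu / 2) / 2) ^+ a.

Let n_gt0 : 0 < n.
Proof.
have b1' := b1.
have : 0 < 4 * b%:R * (2 * b%:R) ^+ a :> R by rewrite !mulr_gt0 ?exprn_gt0 //; lra.
move/lt_le_trans => /(_ _ n_big); rewrite pmulr_rgt0 // /dlt; exact: divr_gt0.
Qed.

(** The density obtained for the lower level does not depend on delta, which
    is what allows the step to be iterated with the same constants. *)
Lemma light_indep_descends sigma delta :
  0 < delta -> (b * b.+1 + 2 * b)%:R * eps < delta * theta ->
  delta * n ^+ b <= tsum b (fun s => (light_indep sigma s)%:R) ->
  ramsey_density * n ^+ b <=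
    tsum b (fun s => (light_indep (sigma - b%:R * (gam * t / 2 * n)) s)%:R).
Proof.
move=> delta0 eps_small many; rewrite leNgt; apply/negP => sparse.
have /andP[g0 g1] := gam01; have b_ge1 := b1; have n0 := n_gt0.
have mu_gt0 := mu0; have mu_le := mu1.
(* Otherwise every tuple of the family is atypical, which is too much for the
   average of the atypicality. *)
suff typ s : size s = b -> light_indep sigma s -> theta * n ^+ 2 <= atypicality s.
  have theta0 : 0 < theta by rewrite /theta divr_gt0 ?exprn_gt0.
  have : theta * n ^+ 2 * (delta * n ^+ b) <= tsum b atypicality.
    apply: le_trans (ler_wpM2l _ many) _; first by rewrite mulr_ge0 ?exprn_ge0 // ltW.
    rewrite -tsumZ; apply: ler_tsum => s sz_s.
    case fs: (light_indep sigma s); first by rewrite mulr1 typ.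
    rewrite mulr0 addr_ge0 ?sumr_ge0 // mulr_ge0 ?common_loss_ge0 //.
  move/le_trans => /(_ _ tsum_atypicality); apply/negP; rewrite -ltNge.
  have -> : theta * n ^+ 2 * (delta * n ^+ b) = delta * theta * n ^+ b.+2.
    by rewrite !exprS; ring.
  by rewrite ltr_pM2r // exprn_gt0.
move=> sz_s /andP[/andP[_ nadj_s] ssum]; rewrite leNgt; apply/negP => small.
set s0 := \sum_(v <- s) dp v in ssum.
pose N := common (rel_diff Gc added) setT s.
pose thr := s0 / b%:R - gam * t / 2 * n.
pose N' := [set u in N | dp u < thr].
pose dev u := `|#|common Gc (nbhd deleted setT u) s|%:R - q ^+ b * dm u|.
pose X := [set u in N | mu / 8 * n < dev u].
pose W := N :\: N' :\: X.
(* A K_a of F inside N would form a forbidden copy together with s. *)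
have noK (Y : {set V}) r : Y \subset N -> size r = a -> ~~ clique F Y r.
  move=> /subsetP sYN sz_r; apply/negP => /andP[rY Fr].
  have := noH sz_r sz_s Fr nadj_s => /negP; apply.
  apply/allP => x /(allP rY)/sYN; rewrite !inE /= => /allP Nx.
  apply/allP => y /Nx; rewrite rel_diff_addedE => /andP[_].
  by rewrite nonadj_sym.
have Edev : \sum_u dev u < theta * n ^+ 2.
  apply: le_lt_trans small; rewrite /atypicality lerDr mulr_ge0 ?common_loss_ge0 //; exact: ltW.
have Egd : common_loss q Gc added setT s <= theta * n.
  rewrite -(ler_pM2l n_gt0); apply: le_trans (_ : atypicality s <= _).
    by rewrite /atypicality lerDl sumr_ge0.
  by apply: le_trans (ltW small) _; rewrite expr2 mulrCA.
have N_big : q ^+ b * n - q ^+ b.-1 * s0 - theta * n <= #|N|%:R.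
  have q01 : 0 <= q <= 1 by rewrite q1 ltW.
  have := @common_loss_lower R V q Gc added setT s q01; rewrite sz_s cardsT.
  by apply: le_trans; rewrite lerB.
(* Vertices of N with too few added pairs would give the cocliques of the
   lower level. *)
have N'_small : #|N'|%:R < dlt * n.
  rewrite ltNge; apply/negP => N'big; move: sparse; apply/negP; rewrite -leNgt.
  have c0 : 0 < (2 * b%:R) ^+ a :> R by rewrite exprn_gt0 //; lra.
  apply: le_trans (_ : (dlt * n / (2 * b%:R) ^+ a / 4) ^+ b <= _).
    rewrite /ramsey_density -exprMn le_eqVlt; apply/orP; left; apply/eqP; congr (_ ^+ _).
    by field; rewrite gt_eqF.
  have N'K r : size r = a -> ~~ clique F N' r.
    by apply: noK; apply/subsetP => z; rewrite inE => /andP[].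
  apply: le_trans (indep_tuples_count b_gt0 symF irrF _ _ N'K) _.
  - by rewrite ler_pdivlMr.
  - by rewrite divfK ?gt_eqF.
  apply: ler_tsum_pred => r sz_r /andP[rN' nr]; rewrite /light_indep /clique nr andbT.
  apply/andP; split; first by apply/allP => z _; rewrite /= inE.
  have le1 : \sum_(v <- r) dp v <= (size r)%:R * thr.
    elim: r rN' {sz_r nr} => [|v r IH] /=; first by rewrite big_nil mul0r.
    move=> /andP[vN' rN']; rewrite big_cons -natr1 mulrDl mul1r addrC.
    by apply: lerD; [apply: IH | move: vN'; rewrite inE => /andP[_ /ltW]].
  apply: le_trans le1 _; rewrite sz_r /thr mulrBr.
  by rewrite mulrC divfK ?lerB // gt_eqF //; lra.
have X_small : #|X|%:R <= mu / 8 * n.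
  have mn0 : 0 < mu / 8 * n by rewrite mulr_gt0 // divr_gt0.
  rewrite -(ler_pM2l mn0); apply: le_trans (_ : \sum_u dev u <= _); last first.
    by apply: le_trans (ltW Edev) _; rewrite /theta; nra.
  rewrite [leLHS]mulr_natr -sumr_const big_mkcond; apply: ler_sum => u _ /=.
  by case: ifP; rewrite ?normr_ge0 // inE => /andP[_ /ltW].
have W_big : q ^+ b * n - q ^+ b.-1 * s0 - (theta + dlt + mu / 8) * n <= #|W|%:R.
  have : #|N|%:R <= #|W|%:R + #|N'|%:R + #|X|%:R :> R.
    rewrite -!natrD ler_nat.
    apply: leq_trans (_ : #|W :|: N' :|: X| <= _)%N.
      apply: subset_leq_card; apply/subsetP => z zN; rewrite !in_setU !in_setD zN andbT.
      by case: (z \in X); case: (z \in N').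
    by apply: leq_trans (leq_card_setU _ _) _; rewrite leq_add2r leq_card_setU.
  lra.
(* In W many added pairs at each vertex leave room for few deleted ones. *)
pose lam := q ^+ b * ((1 - gam) * t * n - thr) + mu / 8 * n.
have s0_le : s0 / b%:R <= (1 - gam) * t * n.
  rewrite ler_pdivrMr; last lra.
  have : s0 <= (size s)%:R * ((1 - gam) * t * n).
    rewrite /s0; elim: (s) => [|v r IH] /=; first by rewrite big_nil mul0r.
    rewrite big_cons -natr1 mulrDl mul1r addrC lerD //.
    by apply: le_trans (degD v); rewrite lerDl.
  by rewrite sz_s mulrC.
have gtn0 : 0 < gam * t * n := mulr_gt0 (mulr_gt0 g0 t0) n0.
have lam0 : 0 <= lam.
  by rewrite addr_ge0 // mulr_ge0 ?ltW //; [rewrite /thr; lra | lra].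
have degW w : w \in W -> deg deleted W w <= lam.
  rewrite !in_setD => /and3P[wX wN' wN].
  move: wX wN'; rewrite [w \in X]in_set [w \in N']in_set wN /= -!leNgt => devw thrw.
  apply: le_trans (_ : #|common Gc (nbhd deleted setT w) s|%:R <= _).
    rewrite ler_nat; apply: subset_leq_card; apply/subsetP => z.
    rewrite !inE => /andP[/and3P[_ _ zN] dz]; rewrite dz /=.
    apply/allP => y ys; move/allP: zN => /(_ _ ys).
    by rewrite rel_diff_addedE => /andP[].
  have := ler_norm (#|common Gc (nbhd deleted setT w) s|%:R - q ^+ b * dm w).
  move/le_trans => /(_ _ devw).
  have := ler_wpM2l (ltW qb0) (_ : dm w <= (1 - gam) * t * n - thr).
  have := degD w; rewrite /lam; lra.
have eta01 : 0 <= mu / 2 <= 1 by lra.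
have p01 : 0 <= p <= 1 by rewrite p1 ltW.
have symA : symmetric (rel_diff G deleted).
  by move=> x y; rewrite !rel_diff_deletedE symG symF.
(* Here the choice of p enters: p = (a-1)t and t/q = 1/b make the terms in n
   and in s0 cancel, up to the surplus coming from gam. *)
have Wineq : a.-1%:R * lam + mu / 2 * n <= p * #|W|%:R.
  apply: le_trans (ler_wpM2l (ltW p0) W_big).
  have qE : t * (q ^+ b.-1 * s0) = q ^+ b * (s0 / b%:R).
    have -> : q ^+ b = q ^+ b.-1 * q by rewrite -exprSr prednK.
    field; lra.
  have thE : theta <= mu / 8 by rewrite /theta; nra.
  have h : lam + mu / 2 * n <= t * (q ^+ b * n - q ^+ b.-1 * s0 - (theta + dlt + mu / 8) * n).
    rewrite (_ : t * _ = t * (q ^+ b * n) - t * (q ^+ b.-1 * s0)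
       - t * ((theta + dlt + mu / 8) * n)); last by ring.
    rewrite /lam /thr qE /dlt.
    have h1 : t * ((theta + mu / 8 + mu / 8) * n) <= 3 * (mu / 8) * n.
      have : (theta + mu / 8 + mu / 8) * n <= 3 * (mu / 8) * n by rewrite ler_pM2r //; lra.
      have : 0 <= (theta + mu / 8 + mu / 8) * n.
        have th0 : 0 <= theta by rewrite /theta divr_ge0 // exprn_ge0 // ltW.
        by apply: mulr_ge0 (ltW n0); lra.
      move=> x0; apply: le_trans; exact: ler_piMl.
    have h2 : q ^+ b * ((1 - gam) * t * n - (s0 / b%:R - gam * t / 2 * n)) =
       t * (q ^+ b * n) - q ^+ b * (s0 / b%:R) - mu * n.
      by rewrite /mu; field; lra.
    rewrite h2; lra.
  have mn : 0 <= mu / 2 * n := mulr_ge0 (divr_ge0 (ltW mu_gt0) (ler0n _ 2)) (ltW n0).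
  apply: le_trans (_ : a.-1%:R * (lam + mu / 2 * n) <= _).
    by rewrite [leRHS]mulrDr lerD2l ler_peMl.
  by rewrite -[leRHS]mulrA ler_wpM2l // ler0n.
have WN : W \subset N by apply/subsetP => z; rewrite !in_setD => /and3P[].
have := greedy_cliques (A := rel_diff G deleted) p01 qrG (fun x y => erefl)
  symA lam0 degW eta01 Wineq eps_small_a.
apply/negP; rewrite -ltNge.
apply: le_lt_trans (_ : tsum a (fun=> 0) < _).
  apply: ler_tsum => r sz_r; rewrite lern0 eqb0.
  apply: contra (noK W r WN sz_r) => /andP[rW Ar]; rewrite /clique rW /=.
  by apply: sub_pairwise Ar => x y; rewrite rel_diff_deletedE => /andP[].
rewrite tsum_const mul0r exprn_gt0 //.
apply: mulr_gt0 n0; apply: divr_gt0 => //; apply: mulr_gt0; first exact: exprn_gt0.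
exact: divr_gt0.
Qed.

(** A density valid both for the cocliques found greedily at the start and for
    those found by each descent. *)
Definition level_density := Num.min ramsey_density ((q ^+ b * t / 2) ^+ b).

Lemma ramsey_density_gt0 : 0 < ramsey_density.
Proof.
have b_ge1 := b1.
rewrite /ramsey_density exprn_gt0 // divr_gt0 //; first exact: divr_gt0.
by rewrite mulr_gt0 // exprn_gt0 //; lra.
Qed.

Lemma level_density_gt0 : 0 < level_density.
Proof.
rewrite /level_density lt_min ramsey_density_gt0 exprn_gt0 //.
exact: divr_gt0 (mulr_gt0 qb0 t0) (ltr0n _ 2).
Qed.

Hypothesis eps_small_b : (b * b.+1)%:R * eps <= (q ^+ b * t / 2) ^+ b.
Hypothesis eps_small_d : (b * b.+1 + 2 * b)%:R * eps < level_density * theta.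

(** The family at level i loses b gam t n / 2 in its bound at each step, and
    so would have to contain tuples with a negative sum. *)
Lemma low_degree_edit_absurd : False.
Proof.
have /andP[g0 g1] := gam01; have n0 := n_gt0; have b_ge1 := b1.
have q01 : 0 <= q <= 1 by rewrite q1 ltW.
have t01 : 0 <= t <= 1 by rewrite t1 ltW.
have dp0 v : 0 <= dp v by rewrite ler0n.
have nb0 : 0 <= n ^+ b by rewrite exprn_ge0 // ltW.
pose c := b%:R * (gam * t / 2).
have c0 : 0 < c.
  exact: mulr_gt0 (lt_le_trans ltr01 b_ge1) (divr_gt0 (mulr_gt0 g0 t0) (ltr0n _ 2)).
pose lam := (1 - gam) * t * n.
have lam0 : 0 <= lam.
  by rewrite /lam mulr_ge0 ?(ltW n0) // mulr_ge0 ?(ltW t0) // subr_ge0.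
have dpl v : dp v <= lam by apply: le_trans (degD v); rewrite lerDl ler0n.
have level i : level_density * n ^+ b <=
    tsum b (fun s => (light_indep (b%:R * lam - i%:R * c * n) s)%:R).
  elim: i => [|i IH]; last first.
    have := light_indep_descends level_density_gt0 eps_small_d IH.
    rewrite (_ : b%:R * lam - i.+1%:R * c * n =
       b%:R * lam - i%:R * c * n - b%:R * (gam * t / 2 * n)); last first.
      by rewrite /c -natr1; ring.
    by apply: le_trans; rewrite ler_wpM2r // /level_density ge_min lexx.
  apply: le_trans (_ : (q ^+ b * t / 2 * n) ^+ b <= _).
    by rewrite exprMn ler_wpM2r // /level_density ge_min lexx orbT.
  have symA : symmetric (rel_diff Gc added).
    by move=> x y; rewrite !rel_diff_addedE /Gc symG nonadj_sym.
  have start : b.-1%:R * lam + t * n <= q * #|[set: V]|%:R.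
    have lam_le : lam <= t * n.
      rewrite /lam ler_wpM2r ?(ltW n0) // ler_piMl ?(ltW t0) //; lra.
    rewrite cardsT -subn1 natrB // -mulrA.
    have b0 : 0 <= b%:R - 1 :> R by rewrite subr_ge0.
    have := ler_wpM2l b0 lam_le; lra.
  have := greedy_cliques (A := rel_diff Gc added) q01 qrGc (fun x y => erefl) symA lam0
    (fun w _ => dpl w) t01 start eps_small_b.
  move/le_trans; apply; apply: ler_tsum_pred => s sz_s /andP[sT As].
  rewrite /light_indep /clique sT /= mul0r mul0r subr0; apply/andP; split.
    by apply: sub_pairwise As => x y; rewrite rel_diff_addedE => /andP[].
  rewrite -sz_s; elim: (s) => [|v r IH] /=; first by rewrite big_nil mul0r.
  by rewrite big_cons -natr1 mulrDl mul1r addrC lerD.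
have := level (Num.bound (b%:R * lam / (c * n))).
have cn0 := mulr_gt0 c0 n0.
have bl0 : 0 <= b%:R * lam / (c * n).
  by apply: divr_ge0 (ltW cn0); apply: mulr_ge0 => //; rewrite ler0n.
have := archi_boundP bl0.
rewrite ltr_pdivrMr //; set i := Num.bound _ => big.
apply/negP; rewrite -ltNge; apply: le_lt_trans (_ : tsum b (fun=> 0) < _).
  apply: ler_tsum => s sz_s; rewrite lern0 eqb0 /light_indep negb_and; apply/orP; right.
  rewrite -ltNge; apply: lt_le_trans (_ : 0 <= _); first by rewrite subr_lt0 -mulrA.
  by rewrite sumr_ge0.
by rewrite tsum_const mul0r mulr_gt0 ?level_density_gt0 ?exprn_gt0.
Qed.

End Graph.
End Core.

Section LowDegree.
Context {R : archiRealFieldType}.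
Variables (a b : nat).
Hypotheses (a_gt1 : (1 < a)%N) (b_gt0 : (0 < b)%N).
Local Notation t := (rate a b : R).
Local Notation p := (a.-1%:R * t).

Definition symdiff (V : finType) (F G : rel V) : rel V := fun x y => F x y (+) G x y.

(** The same with constants chosen.  Half of gam absorbs the unit by which the
    diagonal enlarges the degree of [added]. *)
Lemma low_degree_edit (gam : R) : 0 < gam <= 1 -> exists eps N0 : R, 0 < eps /\
  forall (V : finType) (F G : rel V), N0 <= #|V|%:R :> R -> symmetric F -> irreflexive F ->
  symmetric G -> quasirandom p eps G -> copy_free a b F ->
  (forall v, deg (symdiff F G) setT v <= (1 - gam) * t * #|V|%:R) -> False.
Proof.
move=> /andP[g0 g1].
have t0 : 0 < t := rate_gt0 a_gt1 b_gt0.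
have b1 : 1 <= b%:R :> R by rewrite ler1n.
have a1 : 1 <= a.-1%:R :> R by rewrite ler1n -subn1 subn_gt0.
have p0 : 0 < p by exact: mulr_gt0 (lt_le_trans ltr01 a1) t0.
have q0 : 0 < b%:R * t by exact: mulr_gt0 (lt_le_trans ltr01 b1) t0.
pose g := gam / 2.
have g01 : 0 < g <= 1 by rewrite /g; lra.
have /andP[gg0 _] := g01.
pose mu := (b%:R * t) ^+ b * g * t / 2.
have mu0 : 0 < mu.
  exact: divr_gt0 (mulr_gt0 (mulr_gt0 (exprn_gt0 _ q0) gg0) t0) (ltr0n _ 2).
pose e1 := (p ^+ a * (mu / 2) / 2) ^+ a.
pose e2 := ((b%:R * t) ^+ b * t / 2) ^+ b.
pose e3 := level_density a b g * (mu ^+ 2 / 64).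
have d0 := level_density_gt0 a_gt1 b_gt0 g01.
have e10 : 0 < e1.
  by apply: exprn_gt0; apply: divr_gt0 => //; apply: mulr_gt0; [exact: exprn_gt0 | exact: divr_gt0].
have e20 : 0 < e2.
  apply: exprn_gt0; exact: divr_gt0 (mulr_gt0 (exprn_gt0 _ q0) t0) (ltr0n _ 2).
have e30 : 0 < e3 by apply: mulr_gt0 => //; apply: divr_gt0 => //; exact: exprn_gt0.
pose K : R := (a * a.+1 + (b * b.+1 + 2 * b))%:R + 1.
have K0 : 0 < K by rewrite /K ltr_wpDl // ler0n.
pose e := Num.min e1 (Num.min e2 e3).
have e0 : 0 < e by rewrite /e !lt_min e10 e20 e30.
have Ke : K * (e / K) = e by field; exact: lt0r_neq0.
have eK0 : 0 < e / K by exact: divr_gt0.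
have small m : (m%:R : R) < K -> m%:R * (e / K) < e.
  by move=> mK; rewrite -[ltRHS]Ke ltr_pM2r.
exists (e / K), (Num.max (4 * b%:R * (2 * b%:R) ^+ a / (mu / 8)) (1 / (g * t))).
split => // V F G; rewrite ge_max => /andP[n1 n2] symF irrF symG qr noH degD.
apply: (low_degree_edit_absurd a_gt1 b_gt0 g01 symF irrF symG qr noH).
- move=> v.
  have h : deg (added F G) setT v + deg (deleted F G) setT v
           <= deg (symdiff F G) setT v + 1 :> R.
    rewrite /deg natr1 -natrD ler_nat.
    apply: leq_trans (_ : #|v |: nbhd (symdiff F G) setT v| <= _)%N; last first.
      by rewrite cardsU1 addnC -addn1 leq_add2l leq_b1.
    rewrite -cardsUI (_ : _ :&: _ = set0) ?cards0 ?addn0.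
      apply: subset_leq_card; apply/subsetP => z; rewrite !inE /added /deleted /symdiff eq_sym.
      by case: (G v z); case: (F v z); case: (z == v).
    by apply/setP => z; rewrite !inE /added /deleted; case: (G v z); rewrite ?andbF.
  apply: le_trans h _; have := degD v.
  have gt0 : 0 < g * t by exact: mulr_gt0.
  move: n2; rewrite ler_pdivrMr // => n2.
  move=> dd; apply: le_trans (lerD dd n2) _; rewrite /g le_eqVlt.
  by apply/orP; left; apply/eqP; field.
- have mu8 : 0 < mu / 8 := divr_gt0 mu0 (ltr0n _ 8).
  by move: n1; rewrite ler_pdivrMr // [#|V|%:R * _]mulrC.
- apply: le_trans (ltW (small _ _)) _; last by rewrite /e ge_min lexx.
  by rewrite /K natr1 ltr_nat ltnS leq_addr.
- apply: le_trans (ltW (small _ _)) _; last by rewrite /e !ge_min lexx orbT.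
  by rewrite /K natr1 ltr_nat ltnS addnA addnAC leq_addl.
- apply: lt_le_trans (small _ _) _; last by rewrite /e !ge_min lexx !orbT.
  by rewrite /K natr1 ltr_nat ltnS leq_addl.
Qed.

End LowDegree.

(** * Reduction to bounded changed degrees *)

Section Sums.
Context {R : archiRealFieldType}.

Lemma deg_sum (V : finType) (A : rel V) (X : {set V}) v :
  deg A X v = \sum_(y in X) (A v y)%:R :> R.
Proof.
rewrite /deg -sum1_card natr_sum big_mkcond [RHS]big_mkcond; apply: eq_bigr => y _.
by rewrite inE; case: (y \in X); case: (A v y).
Qed.

Lemma sum_pairs_setD1 (V : finType) (w : V -> V -> R) (U : {set V}) u :
  u \in U -> (forall x y, w x y = w y x) -> w u u = 0 ->
  \sum_(x in U) \sum_(y in U) w x y =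
  \sum_(x in U :\ u) \sum_(y in U :\ u) w x y + 2 * \sum_(y in U) w u y.
Proof.
move=> uU symw wu; rewrite (big_setD1 u) //=.
under [X in _ + X]eq_bigr => x _ do rewrite (big_setD1 u) //= symw.
rewrite big_split /= [\sum_(y in U) w u y](big_setD1 u) //= wu add0r.
ring.
Qed.

End Sums.

Section Induced.
Context {R : archiRealFieldType}.
Variables (V : finType) (U : {set V}).
Local Notation T := {x : V | x \in U}.
Definition induced_rel (A : rel V) : rel T := fun x y => A (val x) (val y).

Lemma card_induced_rel : #|{: T}| = #|U|.
Proof. by rewrite card_sig; apply: eq_card => x; rewrite inE. Qed.

Lemma deg_induced_rel A (Y : {set T}) x : deg (induced_rel A) Y x = deg A (val @: Y) (val x) :> R.
Proof.
rewrite !deg_sum big_imset //=; exact: in2W val_inj.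
Qed.

Lemma quasirandom_induced_rel (rho eps eps' : R) G : quasirandom rho eps G ->
  eps * #|V|%:R ^+ 2 <= eps' * #|U|%:R ^+ 2 -> quasirandom rho eps' (induced_rel G).
Proof.
move=> qr le_eps X Y; rewrite card_induced_rel; apply: le_trans le_eps.
have := qr (val @: X) (val @: Y).
rewrite !card_imset; try exact: val_inj.
rewrite big_imset /=; last exact: in2W val_inj.
by under eq_bigr => x _ do rewrite -deg_induced_rel.
Qed.

Lemma copy_free_induced_rel a b F : copy_free a b F -> copy_free a b (induced_rel F).
Proof.
move=> noH r s sz_r sz_s Fr Fs.
have := noH (map val r) (map val s); rewrite !size_map => /(_ sz_r sz_s).
rewrite !pairwise_map => /(_ Fr).
have -> : pairwise (relpre val (nonadj F)) s.
  by apply: sub_pairwise Fs => x y; rewrite /nonadj /= (inj_eq val_inj).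
move=> /(_ isT); rewrite all_map; apply: contra; apply: sub_all => x.
by rewrite /= all_map; apply: sub_all => y; rewrite /nonadj /= (inj_eq val_inj).
Qed.

End Induced.

Section Edit.
Context {R : archiRealFieldType}.
Variables (a b : nat).
Hypotheses (a_gt1 : (1 < a)%N) (b_gt0 : (0 < b)%N).
Local Notation t := (rate a b : R).
Local Notation p := (a.-1%:R * t).

(** Minimise the number of changed ordered pairs in U minus
    (1 - gam/2) t |U|^2 over all vertex sets U.  The value at the full set is
    very negative, so U has linear size, and no vertex of U has a large changed
    degree, since removing it would lower the value. *)
Lemma edit_lower (gam : R) : 0 < gam <= 1 -> exists eps N0 : R, 0 < eps /\
  forall (V : finType) (F G : rel V), N0 <= #|V|%:R :> R ->
  symmetric F -> irreflexive F -> symmetric G -> irreflexive G ->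
  quasirandom p eps G -> copy_free a b F ->
  (1 - gam) * t * #|V|%:R ^+ 2 <= \sum_v deg (symdiff F G) setT v.
Proof.
move=> /andP[g0 g1].
have gam2 : 0 < gam / 2 <= 1 by lra.
have [eps [N0 [eps0 core]]] := low_degree_edit a_gt1 b_gt0 gam2.
have t0 : 0 < t := rate_gt0 a_gt1 b_gt0.
exists (eps * (gam / 2)), (2 / gam * N0); split; first by rewrite mulr_gt0 //; lra.
move=> V F G n_big symF irrF symG irrG qr noH; rewrite leNgt; apply/negP => few.
set n : R := #|V|%:R in n_big few.
have symD x y : symdiff F G x y = symdiff F G y x by rewrite /symdiff symF symG.
have irrD x : symdiff F G x x = false by rewrite /symdiff irrF irrG.
pose S (U : {set V}) : R := \sum_(x in U) \sum_(y in U) (symdiff F G x y)%:R.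
pose phi U := S U - (1 - gam / 2) * t * #|U|%:R ^+ 2.
pose U := [arg min_(U < [set: V] | true) phi U]%O.
have phiU U' : phi U <= phi U' by rewrite /U; case: arg_minP => // X _; apply.
have phiT : phi setT < - (gam / 2) * t * n ^+ 2.
  have -> : phi setT = \sum_v deg (symdiff F G) setT v - (1 - gam / 2) * t * n ^+ 2.
    rewrite /phi /S cardsT; congr (_ - _).
    by apply: eq_big => [x|x _]; rewrite ?inE ?deg_sum.
  move: few; set e := \sum_v _; nra.
have S0 : 0 <= S U by rewrite !sumr_ge0 // => x _; rewrite sumr_ge0.
have Ubig : gam / 2 * n ^+ 2 < #|U|%:R ^+ 2.
  have := le_lt_trans (phiU setT) phiT; rewrite /phi.
  have u0 : 0 <= #|U|%:R ^+ 2 :> R by rewrite exprn_ge0.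
  rewrite -[gam / 2 * _ < _](ltr_pM2l t0); move: u0; set u := #|U|%:R ^+ 2; set m := n ^+ 2.
  move=> u0; have := mulr_ge0 (mulr_ge0 (divr_ge0 (ltW g0) (ler0n _ 2)) (ltW t0)) u0.
  lra.
apply: (core _ (@induced_rel _ U F) (@induced_rel _ U G)) => //.
- rewrite card_induced_rel leNgt; apply/negP => small.
  have n0 : 0 <= n by rewrite ler0n.
  have u0 : 0 <= #|U|%:R :> R by rewrite ler0n.
  have h1 : N0 <= gam / 2 * n.
    by move: n_big; rewrite mulrAC ler_pdivrMr //; lra.
  move: Ubig small u0; set u := #|U|%:R => Ubig small u0.
  have : u ^+ 2 <= gam / 2 * n * (gam / 2 * n).
    by rewrite expr2 ler_pM //; apply: ltW; apply: lt_le_trans h1.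
  have : gam / 2 * n * (gam / 2 * n) <= gam / 2 * n ^+ 2.
    rewrite (_ : gam / 2 * n * (gam / 2 * n) = gam / 2 * (gam / 2 * n ^+ 2)); last by ring.
    rewrite ler_piMl //; [by rewrite mulr_ge0 ?exprn_ge0 //; lra | lra].
  lra.
- by move=> x y; rewrite /induced_rel symF.
- by move=> x; rewrite /induced_rel irrF.
- by move=> x y; rewrite /induced_rel symG.
- apply: quasirandom_induced_rel qr _; rewrite -mulrA ler_pM2l //; exact: ltW.
- exact: copy_free_induced_rel.
move=> x; rewrite card_induced_rel.
have xU := valP x.
have -> : deg (symdiff (induced_rel F) (induced_rel G)) [set: {x | x \in U}] x = deg (symdiff F G) U (val x) :> R.
  rewrite -[symdiff _ _]/(induced_rel (symdiff F G)) deg_induced_rel !deg_sum; apply: eq_bigl => y.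
  apply/imsetP/idP => [[z _ ->]|yU]; first exact: valP.
  by exists (Sub y yU); rewrite ?inE.
have := phiU (U :\ val x); rewrite /phi {1}/S (sum_pairs_setD1 xU); last first.
- by rewrite irrD.
- by move=> y z; rewrite symD.
rewrite -deg_sum -/(S _) (cardsD1 (val x) U) xU /= natrD.
set d := deg _ _ _; set m := #|_|%:R; set s := S _ => h.
have : 2 * d <= (1 - gam / 2) * t * ((1 + m) ^+ 2 - m ^+ 2) by lra.
rewrite (_ : (1 + m) ^+ 2 - m ^+ 2 = 2 * (1 + m) - 1); last by ring.
have : 0 <= (1 - gam / 2) * t by rewrite mulr_ge0 ?(ltW t0) //; lra.
set c := _ * t; nra.
Qed.

End Edit.

(** * Edge sets, edit distance and colourings *)

Section GraphFacts.
Variable V : finType.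
Implicit Types (P : graph_class) (F G : sgraph V) (S : {set {set V}}).

Lemma adj_sym G : symmetric (adj G).
Proof. by move=> x y; rewrite /adj setUC. Qed.

Lemma edge_card2 G e : e \in edges G -> #|e| = 2%N.
Proof. by move/(subsetP (edges_card2 G)); rewrite inE => /eqP. Qed.

Lemma adj_irr G : irreflexive (adj G).
Proof. by move=> x; apply/negP => /edge_card2; rewrite cards2 eqxx. Qed.

Lemma set2_eq (x y u v : V) : u != v ->
  ([set x; y] == [set u; v]) = ((x == u) && (y == v)) || ((x == v) && (y == u)).
Proof.
move=> uv; apply/eqP/orP => [E|[] /andP[/eqP-> /eqP->] //]; last by rewrite setUC.
have xy : x != y.
  by apply: contra_neq uv => xy; apply/eqP; move: (cards2 u v); rewrite -E xy cards2 eqxx; case: eqP.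
have: x \in [set u; v] by rewrite -E set21.
have: y \in [set u; v] by rewrite -E set22.
rewrite !inE => /orP[] /eqP yE /orP[] /eqP xE; subst; rewrite ?eqxx ?andbT ?orbT; by [left | right | rewrite eqxx in xy].
Qed.

Lemma sum_edges (R : archiRealFieldType) S : (forall e, e \in S -> #|e| = 2%N) ->
  \sum_x \sum_y ([set x; y] \in S)%:R = 2 * #|S|%:R :> R.
Proof.
move=> S2.
have mE x y : ([set x; y] \in S)%:R = \sum_(e in S) ([set x; y] == e)%:R :> R.
  case: (boolP (_ \in S)) => [xyS|nS].
    rewrite (bigD1 _ xyS) /= eqxx big1 ?addr0 // => e /andP[_ ne].
    by rewrite eq_sym (negPf ne).
  by rewrite big1 // => e eS; case: eqP => // xye; rewrite xye eS in nS.
under eq_bigr => x _ do under eq_bigr => y _ do rewrite mE.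
under eq_bigr => x _ do rewrite exchange_big.
rewrite exchange_big /= mulr_natr -sumr_const; apply: eq_bigr => e /S2 /eqP/cards2P[u [v [uv ->]]].
have del z : \sum_(x : V) ((x == z)%:R : R) = 1.
  by rewrite (bigD1 z) //= eqxx big1 ?addr0 // => x /negPf ->.
have orE x y : ([set x; y] == [set u; v])%:R = (x == u)%:R * (y == v)%:R + (x == v)%:R * (y == u)%:R :> R.
  rewrite -!natrM -natrD; congr _%:R; rewrite set2_eq // !mulnb.
  by case: (eqVneq x u) => [->|]; rewrite ?(negPf uv) //= ?addn0 ?orbF.
under eq_bigr => x _ do under eq_bigr => y _ do rewrite orE.
under eq_bigr => x _ do rewrite big_split /= -!mulr_sumr !del !mulr1.
by rewrite big_split /= !del.
Qed.

Lemma sum_deg_symdiff (R : archiRealFieldType) F G :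
  \sum_v deg (symdiff (adj F) (adj G)) setT v = 2 * (edit_dist F G)%:R :> R.
Proof.
rewrite -sum_edges; last first.
  by move=> e; rewrite !inE => /orP[] /andP[_] /edge_card2.
apply: eq_bigr => x _; rewrite deg_sum; apply: eq_big => y; first by rewrite inE.
by move=> _; rewrite !inE /symdiff /adj; case: (_ \in edges F); case: (_ \in edges G).
Qed.

Lemma Dist_le P F G : P V F -> (Dist P G <= edit_dist F G)%N.
Proof. by move=> PF; rewrite /Dist (bigD1 F) //= -leEnat ge_min lexx. Qed.

Lemma Dist_ge (R : archiRealFieldType) P G (c : R) : c <= 'C(#|V|, 2)%:R ->
  (forall F, P V F -> c <= (edit_dist F G)%:R) -> c <= (Dist P G)%:R.
Proof.
move=> c0 cF; rewrite /Dist.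
elim/big_ind: _ => // x y cx cy; by rewrite /Order.min; case: ifP.
Qed.

Lemma card_pairs : #|[set e : {set V} | #|e| == 2%N]| = 'C(#|V|, 2).
Proof. exact: card_draws. Qed.

Lemma edges_le G : (#|edges G| <= 'C(#|V|, 2))%N.
Proof. by rewrite -card_pairs subset_leq_card // edges_card2. Qed.

(** A colouring with the fewest monochromatic pairs: no vertex can lower its
    monochromatic degree by changing colour, so that degree is at most the
    average over the r colours. *)
Lemma good_coloring (R : archiRealFieldType) (A : rel V) r : (0 < r)%N ->
  symmetric A -> irreflexive A -> exists c : V -> 'I_r,
  r%:R * \sum_x \sum_y (A x y && (c x == c y))%:R <= \sum_x \sum_y (A x y)%:R :> R.
Proof.
case: r => // r _ symA irrA.
pose w (c : {ffun V -> 'I_r.+1}) x y : R := (A x y && (c x == c y))%:R.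
pose phi c := \sum_(x in [set: V]) \sum_(y in [set: V]) w c x y.
pose c0 : {ffun V -> 'I_r.+1} := [ffun=> ord0].
pose c := [arg min_(c < c0 | true) phi c]%O.
have phic c' : phi c <= phi c' by rewrite /c; case: arg_minP => // X _; apply.
exists c; rewrite mulr_sumr; apply: ler_sum => u _.
have symw c' x y : w c' x y = w c' y x by rewrite /w symA eq_sym.
have irrw c' : w c' u u = 0 by rewrite /w irrA.
have loc j : \sum_y w c u y <= \sum_y (A u y && (j == c y))%:R.
  pose c' := [ffun z => if z == u then j else c z].
  have := phic c'; rewrite /phi !(sum_pairs_setD1 (in_setT u)) //.
  have -> : \sum_(x in setT :\ u) \sum_(y in setT :\ u) w c' x y =
            \sum_(x in setT :\ u) \sum_(y in setT :\ u) w c x y.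
    apply: eq_bigr => x; rewrite !inE andbT => /negPf xu.
    apply: eq_bigr => y; rewrite !inE andbT => /negPf yu.
    by rewrite /w !ffunE xu yu.
  rewrite lerD2l ler_pM2l // => h.
  have sumT (f : V -> R) : \sum_(y in [set: V]) f y = \sum_y f y.
    by apply: eq_bigl => y; rewrite inE.
  move: h; rewrite !sumT => h.
  apply: le_trans h _; rewrite le_eqVlt; apply/orP; left; apply/eqP.
  apply: eq_bigr => y _; rewrite /w !ffunE eqxx.
  by case: (eqVneq y u) => [->|//]; rewrite irrA.
have : \sum_(j < r.+1) \sum_y w c u y <= \sum_j \sum_y (A u y && (j == c y))%:R.
  by apply: ler_sum => j _; exact: loc.
rewrite sumr_const card_ord mulr_natl => /le_trans; apply.
rewrite exchange_big /= le_eqVlt; apply/orP; left; apply/eqP.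
apply: eq_bigr => y _; rewrite (bigD1 (c y)) //= eqxx andbT big1 ?addr0 // => j /negPf ->.
by rewrite andbF.
Qed.

End GraphFacts.

(** * Graphs free of K_a + E_b *)

Section CliquePlusCoclique.
Variables a b : nat.
Local Notation H := (clique_plus_coclique a b).

Lemma adjH_ll i j : adj H (inl i) (inl j) = (i != j).
Proof.
apply/idP/idP => [E|ij].
  by apply: contraTneq E => ->; rewrite adj_irr.
rewrite /adj /= inE; apply/orP; left; apply/imsetP; exists [set i; j].
  by rewrite inE cards2 ij.
by rewrite imsetU1 imset_set1.
Qed.

Lemma adjH_r x j : adj H x (inr j) = false.
Proof.
apply/negP; rewrite /adj /= inE => /orP[] /imsetP[e].
  by move=> _ E; have := set22 x (inr j); rewrite E => /imsetP[].
by rewrite inE.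
Qed.

Lemma adjH_rr x j : adj H (inr j) x = false.
Proof. by rewrite adj_sym adjH_r. Qed.

Lemma Forb_copy_free (V : finType) (F : sgraph V) : (0 < a)%N ->
  Forb H F -> copy_free a b (adj F).
Proof.
move=> a_gt0 noH r s sz_r sz_s Fr Fs; apply: contra noH => rs; apply/existsP.
have [x0 _] : exists x0 : V, x0 \in r.
  by case: (r) sz_r a_gt0 => [<- //|x r'] _ _; exists x; rewrite mem_head.
pose f (w : 'I_a + 'I_b) := match w with inl i => nth x0 r i | inr j => nth x0 s j end.
have frr (i j : 'I_a) : i != j -> adj F (nth x0 r i) (nth x0 r j).
  move=> ij; have lt (k l : 'I_a) : (k < l)%N -> adj F (nth x0 r k) (nth x0 r l).
    move=> kl; move/(pairwiseP x0): Fr => /(_ k l); rewrite !inE sz_r !ltn_ord; exact.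
  case: (ltngtP i j) => [|/lt|/ord_inj/eqP]; [exact: lt| by rewrite adj_sym | by rewrite (negPf ij)].
have fss (i j : 'I_b) : i != j -> nonadj (adj F) (nth x0 s i) (nth x0 s j).
  move=> ij; have lt (k l : 'I_b) : (k < l)%N -> nonadj (adj F) (nth x0 s k) (nth x0 s l).
    move=> kl; move/(pairwiseP x0): Fs => /(_ k l); rewrite !inE sz_s !ltn_ord; exact.
  case: (ltngtP i j) => [|/lt|/ord_inj/eqP]; [exact: lt| | by rewrite (negPf ij)].
  by rewrite nonadj_sym //; exact: adj_sym.
have frs (i : 'I_a) (j : 'I_b) : nonadj (adj F) (nth x0 r i) (nth x0 s j).
  have /allP/(_ (nth x0 r i)) := rs; rewrite mem_nth ?sz_r // => /(_ isT).
  by move/allP/(_ (nth x0 s j)); rewrite mem_nth ?sz_s // => /(_ isT).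
exists (finfun f); apply/andP; split.
  apply/injectiveP => -[] i [] j; rewrite !ffunE /=.
  - by move=> E; case: (eqVneq i j) => [->//|/frr]; rewrite E adj_irr.
  - by move=> E; have := frs i j; rewrite E /nonadj eqxx.
  - by move=> E; have := frs j i; rewrite E /nonadj eqxx.
  - by move=> E; case: (eqVneq i j) => [->//|/fss]; rewrite E /nonadj eqxx.
apply/forallP => x; apply/forallP => y; rewrite !ffunE; apply/eqP.
case: x y => i [] j; rewrite ?adjH_r ?adjH_rr ?adjH_ll /=.
- by case: eqVneq => [->|/frr //]; rewrite adj_irr.
- by have /andP[_ /negPf] := frs i j.
- by rewrite adj_sym; have /andP[_ /negPf] := frs j i.
- by case: (eqVneq i j) => [->|/fss/andP[_ /negPf]//]; rewrite adj_irr.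
Qed.

Section Upper.
Variables (V : finType) (G : sgraph V).

Definition monochromatic r (c : V -> 'I_r) : {set {set V}} :=
  [set e : {set V} | (#|e| == 2%N) && [forall x in e, forall y in e, c x == c y]].

Lemma mem_monochromatic r (c : V -> 'I_r) x y : ([set x; y] \in monochromatic c) = (x != y) && (c x == c y).
Proof.
rewrite inE cards2 eqSS eqb1; case: eqVneq => //= xy.
apply/forall_inP/eqP => [/(_ x (set21 _ _))/forall_inP/(_ y (set22 _ _))/eqP//|cxy u].
by rewrite !inE => /orP[] /eqP ->; apply/forall_inP => v; rewrite !inE => /orP[] /eqP ->; rewrite ?cxy.
Qed.

Lemma remove_monochromatic_card2 r (c : V -> 'I_r) :
  edges G :\: monochromatic c \subset [set e : {set V} | #|e| == 2].
Proof. by apply: subset_trans (edges_card2 G); exact: subsetDl. Qed.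

Lemma add_monochromatic_card2 r (c : V -> 'I_r) :
  edges G :|: monochromatic c \subset [set e : {set V} | #|e| == 2].
Proof.
rewrite subUset edges_card2; apply/subsetP => e; rewrite !inE => /andP[->] //.
Qed.

(** Pigeonhole: two vertices of the clique share one of the a-1 colours. *)
Lemma Forb_remove (c : V -> 'I_a.-1) : (0 < a)%N -> Forb H (SGraph (remove_monochromatic_card2 c)).
Proof.
move=> a0; apply/negP => /existsP[f /andP[/injectiveP injf /forallP fH]].
suff : injective (fun i : 'I_a => c (f (inl i))).
  by move/leq_card; rewrite !card_ord -ltnS prednK // ltnn.
move=> i j cij; apply/eqP; rewrite -[_ == _]negbK -adjH_ll.
have /forallP/(_ (inl j))/eqP <- := fH (inl i).
apply/negP; rewrite /adj /= in_setD mem_monochromatic cij eqxx andbT negbK => /andP[/eqP fij].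
by rewrite fij => /edge_card2; rewrite cards2 eqxx.
Qed.

(** Pigeonhole: the coclique together with one vertex of the clique forms a
    coclique on b+1 vertices, two of which share one of the b colours. *)
Lemma Forb_add (c : V -> 'I_b) : (0 < a)%N -> Forb H (SGraph (add_monochromatic_card2 c)).
Proof.
move=> a0; apply/negP => /existsP[f /andP[/injectiveP injf /forallP fH]].
pose g (o : option 'I_b) : 'I_a + 'I_b :=
  if o is Some j then inr j else inl (Ordinal a0).
have injg : injective g by move=> [i|] [j|] //= [->].
suff : injective (fun o => c (f (g o))).
  by move/leq_card; rewrite card_option !card_ord ltnn.
move=> o o' co; apply/eqP/negPn/negP => oo'.
have : adj (SGraph (add_monochromatic_card2 c)) (f (g o)) (f (g o')).
  rewrite /adj /= in_setU mem_monochromatic co eqxx andbT.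
  by rewrite (inj_eq injf) (inj_eq injg) oo' orbT.
have /forallP/(_ (g o'))/eqP -> := fH (g o).
by apply/negP; move: o o' oo' {co} => [i|] [j|] //= _; rewrite ?adjH_r ?adjH_rr.
Qed.

Lemma sum_adj (R : archiRealFieldType) :
  \sum_x \sum_y (adj G x y)%:R = 2 * #|edges G|%:R :> R.
Proof. by apply: sum_edges => e; exact: edge_card2. Qed.

Lemma Dist_remove : (1 < a)%N -> (a.-1 * Dist (Forb H) G <= #|edges G|)%N.
Proof.
move=> a1; have r0 : (0 < a.-1)%N by rewrite -subn1 subn_gt0.
have [c] := good_coloring rat r0 (@adj_sym _ G) (@adj_irr _ G).
rewrite sum_adj.
have -> : \sum_x \sum_y (adj G x y && (c x == c y))%:R =
    2 * #|edges G :&: monochromatic c|%:R :> rat.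
  rewrite -sum_edges => [|e]; last by rewrite inE => /andP[/edge_card2].
  apply: eq_bigr => x _; apply: eq_bigr => y _; rewrite in_setI mem_monochromatic /adj.
  by case: (eqVneq x y) => [->|]; rewrite //= -/(adj G y y) adj_irr.
rewrite mulrCA ler_pM2l // -natrM ler_nat; apply: leq_trans; rewrite leq_mul2l.
apply/orP; right; apply: leq_trans (Dist_le G (Forb_remove c (ltnW a1))) _.
apply: subset_leq_card; apply/subsetP => e; rewrite !in_setU !in_setD in_setI.
by case: (e \in edges G); case: (e \in monochromatic c).
Qed.

Lemma Dist_add : (0 < a)%N -> (0 < b)%N ->
  (b * Dist (Forb H) G <= 'C(#|V|, 2) - #|edges G|)%N.
Proof.
move=> a0 b0; pose N : {set {set V}} := [set e : {set V} | #|e| == 2] :\: edges G.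
pose A : rel V := fun x y => [set x; y] \in N.
have AE x y : A x y = (x != y) && ~~ adj G x y.
  by rewrite /A in_setD inE cards2 eqSS eqb1 andbC.
have symA : symmetric A by move=> x y; rewrite /A setUC.
have irrA : irreflexive A by move=> x; rewrite AE eqxx.
have cN : #|N| = ('C(#|V|, 2) - #|edges G|)%N.
  by rewrite cardsD (setIidPr (edges_card2 G)) card_pairs.
have [c] := good_coloring rat b0 symA irrA.
have N2 e : e \in N -> #|e| = 2%N by rewrite in_setD inE => /andP[_ /eqP].
rewrite [X in _ <= X](sum_edges _ N2).
have -> : \sum_x \sum_y (A x y && (c x == c y))%:R = 2 * #|N :&: monochromatic c|%:R :> rat.
  rewrite -sum_edges => [|e]; last by rewrite in_setI => /andP[/N2].
  apply: eq_bigr => x _; apply: eq_bigr => y _; rewrite in_setI mem_monochromatic -/(A x y) AE.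
  by case: (eqVneq x y).
rewrite mulrCA ler_pM2l // -natrM ler_nat cN; apply: leq_trans; rewrite leq_mul2l.
apply/orP; right; apply: leq_trans (Dist_le G (Forb_add c a0)) _.
apply: subset_leq_card; apply/subsetP => e; rewrite /= !inE.
by case: (e \in edges G); case: (#|e| == 2); rewrite ?andbF ?andbT ?orbT ?orbF /=.
Qed.

End Upper.
End CliquePlusCoclique.

(** * Random graphs are quasirandom *)

Section Gnp.
Variables (R : realType) (n : nat) (p : R).
Hypothesis p01 : 0 <= p <= 1.
Local Notation V := 'I_n.
Implicit Types (G : sgraph V) (e : {set V}) (X Y : {set V}).
Local Notation pairs := [set e : {set V} | #|e| == 2].

Definition weight G : R := p ^+ #|edges G| * (1 - p) ^+ ('C(n, 2) - #|edges G|).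

Lemma weight_ge0 G : 0 <= weight G.
Proof. by have /andP[p0 p1] := p01; rewrite mulr_ge0 ?exprn_ge0 // subr_ge0. Qed.

Lemma sum_sgraph (Phi : {set {set V}} -> R) :
  \sum_(G : sgraph V) Phi (edges G) = \sum_(S : {set {set V}} | S \subset pairs) Phi S.
Proof.
rewrite (reindex_onto (@edges V) (insubd (empty_graph V))) /=; last first.
  by move=> S SP; rewrite [edges _]insubdK.
by apply: eq_bigl => G; rewrite edges_card2 valKd eqxx.
Qed.

(** Independence of the edges, as an expansion of a product of binomials. *)
Lemma sum_weight_prod (x y : {set V} -> R) :
  \sum_G weight G * (\prod_(e in pairs) if e \in edges G then x e else y e) =
  \prod_(e in pairs) (p * x e + (1 - p) * y e).
Proof.
rewrite (sum_sgraph (fun S => p ^+ #|S| * (1 - p) ^+ ('C(n, 2) - #|S|) *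
  (\prod_(e in pairs) if e \in S then x e else y e))).
pose F e := if e \in pairs then p * x e else 0.
pose F' e := if e \in pairs then (1 - p) * y e else 1.
have -> : \prod_(e in pairs) (p * x e + (1 - p) * y e) = \prod_e (F e + F' e).
  rewrite big_mkcond; apply: eq_bigr => e _; rewrite /F /F'.
  by case: ifP => //; rewrite add0r.
rewrite bigA_distr [RHS](bigID (fun S : {set {set V}} => S \subset pairs)) /=.
rewrite [X in _ = _ + X]big1 ?addr0 => [|S]; last first.
  case/subsetPn => e eS nep; apply/eqP/prodf_eq0; exists e => //.
  by rewrite eS /F (negPf nep).
apply: eq_bigr => S SP.
have cS : ('C(n, 2) - #|S|)%N = #|pairs :\: S|.
  by rewrite cardsD (setIidPr SP) card_pairs card_ord.
rewrite cS -!prodr_const.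
rewrite [X in X * _](_ : _ = \prod_(e in pairs) if e \in S then p else 1 - p); last first.
  rewrite [RHS](bigID (mem S)) /=; congr (_ * _); apply: eq_big => [e|e].
  - by case: (boolP (e \in S)) => [/(subsetP SP)->|]; rewrite ?andbT ?andbF.
  - by move=> ->.
  - by rewrite in_setD andbC.
  - by rewrite in_setD => /andP[/negPf ->].
rewrite -big_split big_mkcond; apply: eq_bigr => e _ /=; rewrite /F /F'.
case: (boolP (e \in pairs)) => eP; first by case: ifP.
by case: ifP => // /(subsetP SP); rewrite (negPf eP).
Qed.

Lemma sum_weight : \sum_G weight G = 1.
Proof.
have := sum_weight_prod (fun=> 1) (fun=> 1).
rewrite [RHS]big1 => [<-|e _]; last by rewrite !mulr1 addrC subrK.
by apply: eq_bigr => G _; rewrite big1 ?mulr1 // => e _; case: ifP.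
Qed.

(** From exp(-x) >= 1 - x, since (1 - x)(1 + x + 2x^2) >= 1 for x <= 1/2. *)
Lemma expR_le_quad (x : R) : x <= 1 / 2 -> expR x <= 1 + x + 2 * x ^+ 2.
Proof.
move=> x2.
have h := expR_ge1Dx (- x); rewrite expRN in h.
have e0 := expR_gt0 x.
have h1 : (1 - x) * expR x <= 1 by rewrite -ler_pdivlMr // div1r.
have h2 : 1 <= (1 - x) * (1 + x + 2 * x ^+ 2).
  rewrite (_ : (1 - x) * _ = 1 + x ^+ 2 * (1 - 2 * x)); last by ring.
  by rewrite lerDl mulr_ge0 ?sqr_ge0 //; lra.
have x1 : 0 < 1 - x by lra.
by rewrite -(ler_pM2l x1); apply: le_trans h2.
Qed.

(** Deviation of a weighted edge count of G from its mean. *)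
Definition fluct (s : {set V} -> R) G : R :=
  \sum_(e in pairs) s e * ((e \in edges G)%:R - p).

(** The centred edge indicators are independent of mean 0, so the linear terms
    of [expR_le_quad] cancel in each factor. *)
Lemma fluct_mgf (s : {set V} -> R) (lam : R) :
  (forall e, e \in pairs -> `|lam * s e| <= 1 / 2) ->
  \sum_G weight G * expR (lam * fluct s G) <=
    expR (\sum_(e in pairs) 2 * (lam * s e) ^+ 2).
Proof.
move=> small; have /andP[p0 p1] := p01.
pose x e := expR (lam * s e * (1 - p)).
pose y e := expR (- (lam * s e * p)).
rewrite (eq_bigr (fun G => weight G * \prod_(e in pairs)
   if e \in edges G then x e else y e)) => [|G _]; last first.
  congr (_ * _); rewrite /fluct mulr_sumr expR_sum; apply: eq_bigr => e _.
  by rewrite /x /y; case: (e \in edges G); congr expR; rewrite ?mulrA // sub0r mulrN.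
rewrite sum_weight_prod expR_sum; apply: ler_prod => e eP.
have q0 : 0 <= 1 - p by rewrite subr_ge0.
rewrite addr_ge0 ?mulr_ge0 ?expR_ge0 //=.
have := small _ eP; rewrite /x /y; set z := lam * s e; rewrite ler_norml => /andP[z1 z2].
have hx : expR (z * (1 - p)) <= 1 + z * (1 - p) + 2 * (z * (1 - p)) ^+ 2.
  by apply: expR_le_quad; nra.
have hy : expR (- (z * p)) <= 1 + - (z * p) + 2 * (- (z * p)) ^+ 2.
  by apply: expR_le_quad; nra.
apply: le_trans (expR_ge1Dx _).
apply: le_trans (lerD (ler_wpM2l p0 hx) (ler_wpM2l q0 hy)) _.
have -> : p * (1 + z * (1 - p) + 2 * (z * (1 - p)) ^+ 2) +
     (1 - p) * (1 + - (z * p) + 2 * (- (z * p)) ^+ 2) =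
   1 + 2 * z ^+ 2 * (p * (1 - p)) by ring.
rewrite lerD2l ler_piMr //; first by rewrite mulr_ge0 ?sqr_ge0.
nra.
Qed.

Lemma bin2_le : 'C(n, 2)%:R <= n%:R ^+ 2 / 2 :> R.
Proof.
rewrite ler_pdivlMr // -natrX -natrM ler_nat muln2 bin2 -[leqRHS]mulnn.
apply: leq_trans (_ : n * n.-1 <= _)%N; last by rewrite leq_mul2l leq_pred orbT.
by rewrite -[leqRHS]odd_double_half leq_addl.
Qed.

(** Chernoff's bound with the parameter eps / 8, which minimises the
    exponent of the bound and meets the smallness condition of [fluct_mgf]. *)
Lemma fluct_tail (s : {set V} -> R) (eps : R) : 0 < eps <= 1 ->
  (forall e, e \in pairs -> `|s e| <= 2) ->
  \sum_(G | eps * n%:R ^+ 2 < fluct s G) weight G <= expR (- (eps ^+ 2 / 16 * n%:R ^+ 2)).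
Proof.
move=> /andP[e0 e1] s2; pose lam := eps / 8.
have lam0 : 0 < lam by rewrite /lam; lra.
have small e : e \in pairs -> `|lam * s e| <= 1 / 2.
  move=> /s2 h; rewrite normrM gtr0_norm //.
  apply: le_trans (ler_wpM2l (ltW lam0) h) _; rewrite /lam; lra.
apply: le_trans (_ : \sum_G weight G * expR (lam * fluct s G) * expR (- (lam * (eps * n%:R ^+ 2))) <= _).
  rewrite big_mkcond; apply: ler_sum => G _; case: ifP => [h|_]; last first.
    exact: mulr_ge0 (mulr_ge0 (weight_ge0 _) (expR_ge0 _)) (expR_ge0 _).
  rewrite -mulrA -expRD ler_peMr ?weight_ge0 //.
  rewrite -mulrBr; apply: le_trans (expR_ge1Dx _); rewrite lerDl mulr_ge0 ?subr_ge0 ?(ltW h) //.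
  exact: ltW.
rewrite -mulr_suml; apply: le_trans (ler_wpM2r (expR_ge0 _) (fluct_mgf small)) _.
rewrite -expRD ler_expR.
have : \sum_(e in pairs) 2 * (lam * s e) ^+ 2 <= \sum_(e in pairs) 8 * lam ^+ 2.
  apply: ler_sum => e /s2; rewrite exprMn => h.
  have : (s e) ^+ 2 <= 4.
    rewrite -real_normK ?num_real // (_ : 4 = 2 ^+ 2); last by ring.
    by rewrite lerXn2r ?nnegrE.
  have := sqr_ge0 lam; set l := lam ^+ 2; set m := s e ^+ 2; nra.
rewrite sumr_const card_pairs card_ord -[_ *+ 'C(n, 2)]mulr_natr => h.
have lam8 : 0 <= 8 * lam ^+ 2 by rewrite mulr_ge0 ?sqr_ge0.
have h2 := ler_wpM2l lam8 bin2_le.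
apply: le_trans (lerD (le_trans h h2) (lexx _)) _.
rewrite le_eqVlt; apply/orP; left; apply/eqP; rewrite /lam; by field.
Qed.

(** The number of ordered pairs of X x Y that span e, the weight of e in the
    edge count between X and Y. *)
Definition pair_mult X Y e : R := \sum_(x in X) \sum_(y in Y) ([set x; y] == e)%:R.

Lemma pair_mult_bound X Y e : e \in pairs -> `|pair_mult X Y e| <= 2.
Proof.
move=> eP; rewrite ger0_norm; last by rewrite !sumr_ge0 // => x _; rewrite sumr_ge0.
have e2 e' : e' \in [set e] -> #|e'| = 2%N.
  by rewrite inE => /eqP ->; move: eP; rewrite inE => /eqP.
have := sum_edges R e2; rewrite cards1 mulr1 => <-.
rewrite /pair_mult big_mkcond; apply: ler_sum => x _.
case: ifP => _; last by rewrite sumr_ge0.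
rewrite big_mkcond; apply: ler_sum => y _; rewrite inE; by case: ifP.
Qed.

Lemma sum_pair_mult X Y (S : {set {set V}}) : S \subset pairs ->
  \sum_(e in pairs) pair_mult X Y e * (e \in S)%:R = \sum_(x in X) \sum_(y in Y) ([set x; y] \in S)%:R.
Proof.
move=> SP; rewrite /pair_mult.
under eq_bigr => e _ do rewrite mulr_suml.
rewrite exchange_big; apply: eq_bigr => x _ /=.
under eq_bigr => e _ do rewrite mulr_suml.
rewrite exchange_big; apply: eq_bigr => y _ /=.
case: (boolP ([set x; y] \in S)) => [xyS|nS].
  rewrite (bigD1 [set x; y]) ?(subsetP SP) //= eqxx xyS mulr1 big1 ?addr0 // => e /andP[_ ne].
  by rewrite eq_sym (negPf ne) mul0r.
by rewrite big1 // => e _; case: eqP => [<-|]; rewrite ?(negPf nS) ?mulr0 ?mul0r.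
Qed.

(** Pairs (x, x) of X x Y never span an edge; there are at most n of them. *)
Lemma fluct_pair_mult X Y G : `|\sum_(x in X) deg (adj G) Y x - p * #|X|%:R * #|Y|%:R
   - fluct (pair_mult X Y) G| <= n%:R.
Proof.
have /andP[p0 p1] := p01.
rewrite /fluct; under [X in _ - X]eq_bigr => e _ do rewrite mulrBr.
rewrite sumrB sum_pair_mult ?edges_card2 //.
have -> : \sum_(x in X) deg (adj G) Y x = \sum_(x in X) \sum_(y in Y) ([set x; y] \in edges G)%:R :> R.
  by apply: eq_bigr => x _; rewrite deg_sum.
rewrite -mulr_suml.
pose L : R := \sum_(x in X) \sum_(y in Y) (x == y)%:R.
have L0 : 0 <= L by rewrite !sumr_ge0 // => x _; rewrite sumr_ge0.
have Ln : L <= n%:R.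
  apply: le_trans (_ : \sum_(x in X) 1 <= _); last first.
    by rewrite sumr_const -[n in n%:R]card_ord ler_nat max_card.
  apply: ler_sum => x _; rewrite big_mkcond (bigD1 x) //= big1 => [|y /negPf yx].
    by rewrite eqxx addr0; case: ifP.
  by rewrite eq_sym yx; case: ifP.
have E : \sum_(e in pairs) pair_mult X Y e = #|X|%:R * #|Y|%:R - L.
  have := sum_pair_mult X Y (subxx pairs).
  rewrite (eq_bigr (pair_mult X Y)) => [->|e ->]; last by rewrite mulr1.
  rewrite mulr_natl -sumr_const -sumrB; apply: eq_bigr => x _.
  rewrite -[#|Y|%:R]sumr_const -sumrB; apply: eq_bigr => y _.
  by rewrite inE cards2; case: (eqVneq x y); rewrite ?subrr ?subr0.
set A := \sum_(x in X) _.
rewrite E (_ : _ - _ - _ = - (p * L)); last by ring.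
rewrite normrN ger0_norm ?mulr_ge0 //.
by apply: le_trans Ln; rewrite ler_piMl.
Qed.

Definition is_quasirandom (eps : R) : pred (sgraph V) := fun G =>
  [forall X : {set V}, forall Y : {set V},
    `|\sum_(x in X) deg (adj G) Y x - p * #|X|%:R * #|Y|%:R| <= eps * n%:R ^+ 2].

Lemma is_quasirandomP eps G : is_quasirandom eps G -> quasirandom p eps (adj G).
Proof. by move=> /forallP h X Y; have /forallP/(_ Y) := h X; rewrite card_ord. Qed.

(** Union bound over the 4^n pairs of vertex sets and the two signs.  As
    4^n <= exp(2n), the constant 192 = 3 * 64 makes each tail at most
    exp(-3n). *)
Lemma Gnp_not_quasirandom eps : 0 < eps <= 1 -> 2 <= eps * n%:R -> 192 <= eps ^+ 2 * n%:R ->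
  Gnp_prob p (predC (is_quasirandom eps)) <= 2 / n.+1%:R.
Proof.
move=> /andP[e0 e1] nbig nbig2.
pose T (sg : R) XY : pred (sgraph V) := fun G =>
  eps / 2 * n%:R ^+ 2 < fluct (fun e => sg * pair_mult XY.1 XY.2 e) G.
have n0 : 0 <= n%:R :> R by rewrite ler0n.
pose bnd : R := expR (- ((eps / 2) ^+ 2 / 16 * n%:R ^+ 2)).
have tail sg XY : `|sg| = 1 -> \sum_(G | T sg XY G) weight G <= bnd.
  move=> sg1; apply: fluct_tail; first by lra.
  by move=> e eP; rewrite normrM sg1 mul1r pair_mult_bound.
have cover G : ~~ is_quasirandom eps G ->
    1 <= \sum_XY ((T 1 XY G)%:R + (T (-1) XY G)%:R) :> R.
  rewrite negb_forall => /existsP[X]; rewrite negb_forall => /existsP[Y].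
  rewrite -ltNge => big.
  rewrite (bigD1 (X, Y)) //= ler_wpDr //.
    by apply: sumr_ge0 => XY _; rewrite addr_ge0.
  have := fluct_pair_mult X Y G.
  set f := fluct _ G; set d := _ - p * _ * _ in big * => h.
  have fbig : eps / 2 * n%:R ^+ 2 < `|f|.
    have : `|d| <= `|d - f| + `|f| by rewrite -{1}(subrK f d) ler_normD.
    have : n%:R <= eps / 2 * n%:R ^+ 2 by nra.
    lra.
  have T1 : T 1 (X, Y) G = (eps / 2 * n%:R ^+ 2 < f).
    by rewrite /T /f /fluct; congr (_ < _); apply: eq_bigr => e _; rewrite mul1r.
  have T2 : T (-1) (X, Y) G = (eps / 2 * n%:R ^+ 2 < - f).
    rewrite /T /f /fluct -sumrN; congr (_ < _); apply: eq_bigr => e _.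
    by rewrite mulN1r mulNr.
  by rewrite T1 T2; case: (ler0P f) fbig => _ ->; rewrite ?lerDr ?lerDl.
have : Gnp_prob p (predC (is_quasirandom eps)) <=
   \sum_(XY : {set V} * {set V}) (bnd + bnd).
  apply: le_trans (_ : \sum_G \sum_XY weight G * ((T 1 XY G)%:R + (T (-1) XY G)%:R) <= _).
    rewrite /Gnp_prob big_mkcond; apply: ler_sum => G _.
    rewrite -mulr_sumr; case: ifP => [/cover h|_].
      by rewrite -/(weight G) ler_peMr ?weight_ge0.
    by rewrite mulr_ge0 ?weight_ge0 // sumr_ge0 // => XY _; rewrite addr_ge0.
  rewrite exchange_big; apply: ler_sum => XY _ /=.
  have half sg : `|sg| = 1 -> \sum_G weight G * (T sg XY G)%:R <= bnd.
    move=> /(tail sg XY); rewrite big_mkcond; apply: le_trans.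
    by apply: ler_sum => G _; case: ifP; rewrite ?mulr1 ?mulr0.
  under eq_bigr => G _ do rewrite mulrDr.
  by rewrite big_split /= lerD // half ?normrN ?normr1.
move/le_trans; apply.
have two_e : 2 ^+ n <= expR n%:R :> R.
  rewrite (_ : expR n%:R = expR 1 ^+ n :> R); last by rewrite -expRM_natl mulr1.
  rewrite lerXn2r ?nnegrE ?expR_ge0 //.
  by apply: le_trans (expR_ge1Dx 1); lra.
have sets : #|{: {set V}}| = (2 ^ n)%N.
  by rewrite -cardsT -powersetT card_powerset cardsT card_ord.
rewrite sumr_const card_prod sets -[_ *+ _]mulr_natr natrM !natrX.
have bnd_le : bnd <= expR (- (3 * n%:R)).
  rewrite ler_expR lerN2.
  rewrite (_ : (eps / 2) ^+ 2 / 16 * n%:R ^+ 2 = eps ^+ 2 * n%:R / 64 * n%:R); last by field.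
  by rewrite ler_wpM2r //; lra.
have b0 : 0 <= bnd := expR_ge0 _.
have e2n : 2 ^+ n * 2 ^+ n <= expR n%:R * expR n%:R :> R.
  by rewrite ler_pM ?exprn_ge0.
apply: le_trans (_ : (expR (- (3 * n%:R)) + expR (- (3 * n%:R))) * (expR n%:R * expR n%:R) <= _).
  by apply: ler_pM; rewrite ?addr_ge0 ?mulr_ge0 ?exprn_ge0 // lerD.
rewrite mulrDl -!expRD (_ : - (3 * n%:R) + (n%:R + n%:R) = - n%:R); last by ring.
rewrite -mulr2n -[_ *+ 2]mulr_natl expRN ler_wpM2l // lef_pV2 ?posrE ?expR_gt0 ?ltr0Sn //.
by rewrite -natr1 addrC expR_ge1Dx.
Qed.

End Gnp.

(** * Asymptotics *)

Local Open Scope classical_set_scope.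
Local Open Scope ring_scope.

Section Main.
Context {R : realType}.
Section Prob.
Variables (n : nat) (p : R).
Hypothesis p01 : 0 <= p <= 1.
Implicit Types (A B : pred (sgraph 'I_n)).

Lemma Gnp_prob_ge0 A : 0 <= Gnp_prob p A.
Proof. by apply: sumr_ge0 => G _; exact: weight_ge0. Qed.

Lemma Gnp_prob_mono A B : (forall G, A G -> B G) -> Gnp_prob p A <= Gnp_prob p B.
Proof.
move=> AB; rewrite /Gnp_prob big_mkcond [leRHS]big_mkcond; apply: ler_sum => G _.
have w0 := weight_ge0 p01 G.
by case: ifP => [/AB ->//|_]; case: ifP.
Qed.

Lemma Gnp_probC A : Gnp_prob p (predC A) = 1 - Gnp_prob p A.
Proof.
apply/eqP; rewrite eq_sym subr_eq -(sum_weight n p); apply/eqP.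
by rewrite (bigID A) addrC.
Qed.
End Prob.

Variables (a b : nat).
Hypotheses (a_gt1 : (1 < a)%N) (b_gt0 : (0 < b)%N).
Local Notation t := (rate a b : R).
Local Notation p := (a.-1%:R * t).
Local Notation P := (Forb (clique_plus_coclique a b)).

Lemma rate_mul : (a.-1%:R + b%:R) * t = 1.
Proof. by rewrite mulrDl rate_split. Qed.

Lemma ab_ge2 : 2 <= a.-1%:R + b%:R :> R.
Proof. by rewrite -natrD ler_nat -[2%N]addn1 leq_add // -subn1 subn_gt0. Qed.

Lemma rate_le_half : t <= 1 / 2.
Proof. have := rate_mul; have := ab_ge2; have := @rate_gt0 R a b a_gt1 b_gt0; nra. Qed.

Lemma pstar01 : 0 <= p <= 1.
Proof.
have t0 := @rate_gt0 R a b a_gt1 b_gt0.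
have := @rate_split R a b a_gt1 b_gt0.
have : 0 <= a.-1%:R * t by rewrite mulr_ge0 // ltW.
have : 0 <= b%:R * t by rewrite mulr_ge0 // ltW.
lra.
Qed.

Lemma DistMax_le n : (DistMax P n)%:R <= t * 'C(n, 2)%:R :> R.
Proof.
have [t0 a0] := (@rate_gt0 R a b a_gt1 b_gt0, ltnW a_gt1).
suff h : ((a.-1 + b) * DistMax P n <= 'C(n, 2))%N.
  have : (a.-1%:R + b%:R) * (DistMax P n)%:R <= 'C(n, 2)%:R :> R.
    by rewrite -natrD -natrM ler_nat.
  by move/(ler_wpM2l (ltW t0)); rewrite mulrA [t * (_ + _)]mulrC rate_mul mul1r.
rewrite /DistMax; have [|G ->] := @bigop.eq_bigmax (sgraph 'I_n) (@Dist P 'I_n).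
  by apply/card_gt0P; exists (empty_graph 'I_n).
rewrite mulnDl; have h1 := Dist_remove b G a_gt1; have h2 := Dist_add G a0 b_gt0.
have h3 := edges_le G; rewrite card_ord in h2 h3.
by apply: leq_trans (leq_add h1 h2) _; rewrite subnKC.
Qed.

Lemma Dist_lower (gam : R) : 0 < gam <= 1 -> exists2 eps : R, 0 < eps <= 1 &
  \forall n \near \oo, forall G : sgraph 'I_n, is_quasirandom p eps G ->
    (1 - gam) * t * (n%:R ^+ 2 / 2) <= (Dist P G)%:R.
Proof.
move=> gam01; have [eps [N0 [eps0 low]]] := @edit_lower R a b a_gt1 b_gt0 gam gam01.
have t0 := @rate_gt0 R a b a_gt1 b_gt0.
exists (Num.min eps 1); first by rewrite lt_min eps0 ltr01 ge_min lexx orbT.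
near=> n => G qr.
have n0 : 0 <= n%:R :> R by rewrite ler0n.
apply: Dist_ge => [|F PF].
  rewrite card_ord.
  have n2 : 2 <= n%:R :> R by near: n; exact: nbhs_infty_ger.
  have -> : 'C(n, 2)%:R = n%:R * (n%:R - 1) / 2 :> R.
    have n_gt0 : (0 < n)%N by rewrite -(ltr_nat R); lra.
    have := mul_bin_diag n 1; rewrite bin1 => /(congr1 (fun k => k%:R : R)).
    rewrite !natrM -subn1 natrB // => e; apply: (mulIf (_ : 2 != 0 :> R)) => //.
    by rewrite divfK // mulrC -e.
  have := rate_le_half; have /andP[g0 g1] := gam01 => th.
  have : (1 - gam) * t <= 1 / 2 by nra.
  move: ((1 - gam) * t) => c c2.
  by rewrite mulrA ler_pM2r //; nra.
have := low _ (adj F) (adj G) _ (@adj_sym _ F) (@adj_irr _ F) (@adj_sym _ G) (@adj_irr _ G).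
rewrite card_ord sum_deg_symdiff => h.
have {}h : (1 - gam) * t * n%:R ^+ 2 <= 2 * (edit_dist F G)%:R.
  apply: h; first by near: n; exact: nbhs_infty_ger.
    move=> X Y; apply: le_trans (is_quasirandomP qr X Y) _.
    by rewrite ler_wpM2r ?exprn_ge0 // ge_min lexx.
  exact: Forb_copy_free (ltnW a_gt1) PF.
by lra.
Unshelve. all: by end_near.
Qed.

Lemma quasirandom_whp (r eps : R) : 0 <= r <= 1 -> 0 < eps <= 1 ->
  \forall n \near \oo, Gnp_prob r (predC (@is_quasirandom R n r eps)) <= 2 / n.+1%:R.
Proof.
move=> r01 e01; have /andP[e0 e1] := e01.
near=> n; apply: Gnp_not_quasirandom => //.
- by rewrite mulrC -ler_pdivrMr //; near: n; exact: nbhs_infty_ger.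
- rewrite mulrC -ler_pdivrMr ?exprn_gt0 //; near: n; exact: nbhs_infty_ger.
Unshelve. all: by end_near.
Qed.

Lemma inv_near (e : R) : 0 < e -> \forall n \near \oo, 2 / n.+1%:R <= e.
Proof.
move=> e0; near=> n; rewrite ler_pdivrMr // mulrC -ler_pdivrMr //.
apply: le_trans (_ : n%:R <= _); last by rewrite ler_nat.
by near: n; exact: nbhs_infty_ger.
Unshelve. all: by end_near.
Qed.

Lemma Dist_le_max n (G : sgraph 'I_n) : (Dist P G <= DistMax P n)%N.
Proof. exact: leq_bigmax. Qed.

Lemma DistMax_lower (gam : R) : 0 < gam <= 1 ->
  \forall n \near \oo, (1 - gam) * t * (n%:R ^+ 2 / 2) <= (DistMax P n)%:R.
Proof.
move=> gam01; have [eps eps01 low] := Dist_lower gam01.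
near=> n.
have [G qr] : exists G : sgraph 'I_n, is_quasirandom p eps G.
  apply/existsP; apply: contraT; rewrite negb_exists => /forallP noG.
  have : Gnp_prob p (predC (@is_quasirandom R n p eps)) <= 1 / 2.
    apply: (@le_trans _ _ (2 / n.+1%:R)); near: n.
      exact: quasirandom_whp pstar01 eps01.
    by apply: inv_near; lra.
  rewrite (_ : Gnp_prob _ _ = 1) => [|]; first by lra.
  rewrite -[RHS](sum_weight n p); apply: eq_bigl => G; exact: noG.
apply: le_trans (_ : (Dist P G)%:R <= _); last by rewrite ler_nat Dist_le_max.
by move: G qr; near: n.
Unshelve. all: by end_near.
Qed.

Lemma dstar_eq : is_dstar P t.
Proof.
have t0 := @rate_gt0 R a b a_gt1 b_gt0.
apply/cvgrPdist_le => e e0.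
pose gam := Num.min e 1.
have gam01 : 0 < gam <= 1 by rewrite lt_min e0 ltr01 ge_min lexx orbT.
have gam_e : gam <= e by rewrite ge_min lexx.
near=> n.
have n2 : (2 <= n)%N by near: n; exact: nbhs_infty_ge.
have c0 : 0 < 'C(n, 2)%:R :> R by rewrite ltr0n bin_gt0.
have up := DistMax_le n.
have lo : (1 - gam) * t * (n%:R ^+ 2 / 2) <= (DistMax P n)%:R.
  by near: n; exact: DistMax_lower.
have {}lo : (1 - gam) * t * 'C(n, 2)%:R <= (DistMax P n)%:R.
  apply: le_trans lo; rewrite ler_wpM2l ?bin2_le //.
  by have /andP[g0 g1] := gam01; rewrite mulr_ge0 ?(ltW t0) // subr_ge0.
rewrite -ler_pdivlMr // in lo; rewrite -ler_pdivrMr // in up.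
rewrite ger0_norm ?subr_ge0 //.
have gam_t : gam * t <= e.
  by have := rate_le_half; have /andP[g0 g1] := gam01; nra.
lra.
Unshelve. all: by end_near.
Qed.

Lemma pstar_holds : is_pstar P p.
Proof.
have t0 := @rate_gt0 R a b a_gt1 b_gt0.
split; first exact: pstar01.
move=> eps eps0; pose gam := Num.min eps 1.
have gam01 : 0 < gam <= 1 by rewrite lt_min eps0 ltr01 ge_min lexx orbT.
have gam_e : gam <= eps by rewrite ge_min lexx.
have [e e01 low] := Dist_lower gam01.
apply/cvgrPdist_le => d d0; near=> n.
set A := (X in Gnp_prob _ X).
rewrite -Gnp_probC ger0_norm; last exact: Gnp_prob_ge0 pstar01 _.
apply: le_trans (_ : Gnp_prob p (predC (@is_quasirandom R n p e)) <= _).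
  apply: (Gnp_prob_mono pstar01) => G /=; apply: contra => qr.
  have lo : (1 - gam) * t * (n%:R ^+ 2 / 2) <= (Dist P G)%:R by move: G qr; near: n.
  have up := le_trans (DistMax_le n) (ler_wpM2l (ltW t0) (bin2_le R n)).
  rewrite /A ger0_norm ?subr_ge0 ?ler_nat ?Dist_le_max //.
  have n0 : 0 <= n%:R ^+ 2 :> R by rewrite exprn_ge0.
  have gt_ : gam * t <= eps by have := rate_le_half; have /andP[g0 g1] := gam01; nra.
  move: lo up n0; set m := n%:R ^+ 2; nra.
apply: (@le_trans _ _ (2 / n.+1%:R)); near: n; first exact: quasirandom_whp pstar01 e01.
exact: inv_near.
Unshelve. all: by end_near.
Qed.

Lemma edges_quasirandom n (r e : R) (G : sgraph 'I_n) : is_quasirandom r e G ->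
  `|2 * #|edges G|%:R - r * n%:R ^+ 2| <= e * n%:R ^+ 2.
Proof.
move=> /is_quasirandomP/(_ setT setT).
rewrite cardsT card_ord -mulrA -expr2 -(sum_adj G); apply: le_trans.
rewrite (_ : \sum_(x in _) _ = \sum_x \sum_y (adj G x y)%:R) //.
apply: eq_big => x; first by rewrite inE.
by move=> _; rewrite deg_sum; apply: eq_bigl => y; rewrite inE.
Qed.

(** Some graph is at once quasirandom of density r and a near-maximiser of the
    distance, so a gap below t for the quasirandom graphs of density r
    contradicts the lower bound on the maximum. *)
Lemma pstar_gap_absurd (r k : R) : is_pstar P r -> 0 < k <= 1 ->
  (forall n (G : sgraph 'I_n), is_quasirandom r (k / 4) G ->
     (Dist P G)%:R <= (t - k + k / 4) * (n%:R ^+ 2 / 2)) -> False.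
Proof.
move=> [r01 conc] k01 small.
have /andP[k0 k1] := k01.
have k4 : 0 < k / 4 <= 1 by lra.
have k8 : 0 < k / 8 by lra.
have /cvgrPdist_le/(_ (1 / 3)) := conc _ k8 => /(_ ltac:(lra)) near_prob.
have low := DistMax_lower k4.
have qr := quasirandom_whp r01 k4.
have inv := @inv_near (1 / 3) ltac:(lra).
have pos : \forall n \near \oo, 1 <= n%:R :> R := nbhs_infty_ger 1.
have [n [hp hl hq hi hn]] : exists n, [/\
    `|1 - Gnp_prob r (fun G : sgraph 'I_n => `|(DistMax P n)%:R - (Dist P G)%:R| <= k / 8 * n%:R ^+ 2)| <= 1 / 3,
    (1 - k / 4) * t * (n%:R ^+ 2 / 2) <= (DistMax P n)%:R,
    Gnp_prob r (predC (@is_quasirandom R n r (k / 4))) <= 2 / n.+1%:R,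
    2 / n.+1%:R <= 1 / 3 :> R & 1 <= n%:R :> R].
  apply: (@filter_ex _ \oo); near=> n; split; by near: n.
have [G /andP[close qrG]] : exists G : sgraph 'I_n,
    (`|(DistMax P n)%:R - (Dist P G)%:R| <= k / 8 * n%:R ^+ 2) && is_quasirandom r (k / 4) G.
  apply/existsP; apply: contraT; rewrite negb_exists => /forallP noG.
  have : Gnp_prob r (fun G : sgraph 'I_n => `|(DistMax P n)%:R - (Dist P G)%:R| <= k / 8 * n%:R ^+ 2)
     <= Gnp_prob r (predC (@is_quasirandom R n r (k / 4))).
    by apply: Gnp_prob_mono => // G h; have := noG G; rewrite h.
  move=> le1; have := le_trans le1 (le_trans hq hi); have := le_trans (ler_norm _) hp.
  by set q := Gnp_prob _ _; lra.
have := small _ _ qrG; have := rate_le_half; have := @rate_gt0 R a b a_gt1 b_gt0.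
move: close; rewrite ler_norml => /andP[_].
have m1 : 1 <= n%:R ^+ 2 :> R by rewrite exprn_ege1.
move: hl m1; set m := n%:R ^+ 2; set M := (DistMax _ _)%:R; set D := (Dist _ _)%:R.
move=> hl m1 hM t0 th hD.
have : (1 - k / 4) * t * (m / 2) <= (t - k + k / 4 + k / 4) * (m / 2) by lra.
rewrite ler_pM2r; last lra.
nra.
Unshelve. all: by end_near.
Qed.

(** A density below p makes deleting edges cheap, a density above p makes
    adding pairs cheap. *)
Lemma pstar_unique (r : R) : is_pstar P r -> r = p.
Proof.
move=> hr; have [/andP[r0 r1] _] := hr.
have t0 := @rate_gt0 R a b a_gt1 b_gt0; have th := rate_le_half.
have pq := @rate_split R a b a_gt1 b_gt0.
have a1 : 1 <= a.-1%:R :> R by rewrite ler1n -subn1 subn_gt0.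
have b1 : 1 <= b%:R :> R by rewrite ler1n.
have a0 : 0 < a.-1%:R :> R := lt_le_trans ltr01 a1.
have b0 : 0 < b%:R :> R := lt_le_trans ltr01 b1.
case: (ltgtP r p) => // cmp; exfalso.
  pose k := t - r / a.-1%:R.
  have kE : a.-1%:R * (t - k) = r by rewrite /k subKr mulrC divfK // lt0r_neq0.
  have k0 : 0 < k by rewrite /k subr_gt0 ltr_pdivrMr // mulrC.
  have r_a : 0 <= r / a.-1%:R by rewrite divr_ge0 // ltW.
  apply: (@pstar_gap_absurd r k) => //; first by rewrite k0 /k; lra.
  move=> n G /edges_quasirandom; rewrite ler_norml => /andP[_ h].
  have := Dist_remove b G a_gt1; rewrite -(ler_nat R) natrM => h2.
  rewrite -(ler_pM2l a0); apply: le_trans h2 _.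
  have n0 : 0 <= n%:R ^+ 2 :> R by rewrite exprn_ge0.
  rewrite (_ : a.-1%:R * _ = a.-1%:R * (t - k) * (n%:R ^+ 2 / 2) + a.-1%:R * (k / 4 * (n%:R ^+ 2 / 2))); last by ring.
  rewrite kE.
  have x0 : 0 <= k / 4 * (n%:R ^+ 2 / 2) by rewrite !mulr_ge0 // ltW.
  have := ler_wpM2r x0 a1; rewrite mul1r.
  lra.
pose k := t - (1 - r) / b%:R.
have kE : b%:R * (t - k) = 1 - r by rewrite /k subKr mulrC divfK // lt0r_neq0.
have k0 : 0 < k by rewrite /k subr_gt0 ltr_pdivrMr // mulrC; lra.
have r_b : 0 <= (1 - r) / b%:R by rewrite divr_ge0 // ?(ltW b0) // subr_ge0.
apply: (@pstar_gap_absurd r k) => //; first by rewrite k0 /k; lra.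
move=> n G /edges_quasirandom; rewrite ler_norml => /andP[h _].
have := Dist_add G (ltnW a_gt1) b_gt0; rewrite -(ler_nat R) natrM => h2.
rewrite natrB ?edges_le // card_ord in h2.
have C2 := bin2_le R n.
rewrite -(ler_pM2l b0); apply: le_trans h2 _.
have n0 : 0 <= n%:R ^+ 2 :> R by rewrite exprn_ge0.
rewrite (_ : b%:R * _ = b%:R * (t - k) * (n%:R ^+ 2 / 2) + b%:R * (k / 4 * (n%:R ^+ 2 / 2))); last by ring.
rewrite kE.
have x0 : 0 <= k / 4 * (n%:R ^+ 2 / 2) by rewrite !mulr_ge0 // ltW.
have := ler_wpM2r x0 b1; rewrite mul1r.
lra.
Qed.

End Main.

Theorem theorem12 (R : realType) (a b : nat) (ha : (2 <= a)%N)
    (hb : (1 <= b)%N) :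
  is_dstar (Forb (clique_plus_coclique a b)) (1 / (a%:R + b%:R - 1) : R) /\
  (forall p : R,
    is_pstar (Forb (clique_plus_coclique a b)) p <->
    p = (a%:R - 1) / (a%:R + b%:R - 1)).
Proof.
split; first exact: dstar_eq.
have E : (a%:R - 1) / (a%:R + b%:R - 1) = a.-1%:R * rate a b :> R.
  by rewrite /rate mulrA mulr1 -subn1 natrB // ltnW.
move=> p; rewrite E; split=> [|->]; [exact: pstar_unique | exact: pstar_holds].
Qed.
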